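(* Let $f:\mathbb{R}^d\to\mathbb{R}$ be $\beta$-smooth with minimum value $f^\star$, and run AdaSGD (as defined in the context) for $T$ steps with parameters $\eta,\gamma>0$ using a stochastic gradient oracle with bounded affine noise with parameters $\sigma_0,\sigma_1\ge 0$. Then for any $\delta\in(0,1/3)$, with probability at least $1-\delta$: (i) $\displaystyle \frac1T\sum_{t=1}^T\|\nabla f(w_t)\|^2 \le O\Big(\tfrac{2F}{\eta}+\eta\beta\Big)\frac{\sigma_0}{\sqrt T} + O\Big(\tfrac{\gamma}{\eta}\Delta_1 + \big(1+\sigma_1^2\log\tfrac1\delta\big)\big(\tfrac{2F}{\eta}+\eta\beta\big)^2 + \sigma_0^2\log\tfrac1\delta\Big)\frac1T$; (ii) $f(w_t)-f^\star\le F$ for all $1\le t\le T+1$, where $\Delta_1=f(w_1)-f^\star$, $$F = 2\Delta_1 + \big(3\log\tfrac{T}{\delta}+4C_1\big)\eta\sigma_0 + \big(9\log^2\tfrac{T}{\delta}+16C_1^2\big)\eta^2\beta\sigma_1^2 + \eta^2\beta C_1,$$ $$C_1=\log\Big(1+\frac{2\sigma_0^2T + 8(1+\sigma_1^2)(\eta^2\beta^2T^3+\beta\Delta_1T)}{\gamma^2}\Big).$$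
   Context: $\|\cdot\|$ is the Euclidean norm and $\log$ denotes the base-2 logarithm. $f$ is $\beta$-smooth: $\|\nabla f(x)-\nabla f(y)\|\le\beta\|x-y\|$ for all $x,y$; $f$ is lower bounded and attains its minimum $f^\star=\min_w f(w)$. Oracle: queried at $w$, it returns a random vector $g(w)$ with $\mathbb{E}[g(w)\mid w]=\nabla f(w)$ and, with probability one, $\|g(w)-\nabla f(w)\|^2\le\sigma_0^2+\sigma_1^2\|\nabla f(w)\|^2$. AdaSGD: starting from an arbitrary $w_1\in\mathbb{R}^d$, for $t=1,\dots,T$, let $g_t=g(w_t)$ be a fresh oracle answer (so $\mathbb{E}[g_t\mid g_1,\dots,g_{t-1}]=\nabla f(w_t)$), $\eta_t=\eta/\sqrt{\gamma^2+\sum_{s=1}^t\|g_s\|^2}$, and $w_{t+1}=w_t-\eta_t g_t$. The $O(\cdot)$ hides absolute constants. *)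

(* Defs.v *)
From HB Require Import structures.
From mathcomp Require Import all_boot all_order all_algebra.
From mathcomp Require Import all_classical all_reals all_analysis.
Set Implicit Arguments. Unset Strict Implicit. Unset Printing Implicit Defensive.
Import Order.TTheory GRing.Theory Num.Theory.
Import numFieldNormedType.Exports.
Local Open Scope classical_set_scope.
Local Open Scope ring_scope.

Section Defs.
Variables (R : realType) (d : nat).

Definition sqnorm (v : 'rV[R]_d) : R := \sum_(i < d) (v ord0 i) ^+ 2.
Definition enorm (v : 'rV[R]_d) : R := Num.sqrt (sqnorm v).
Definition dotp (u v : 'rV[R]_d) : R := \sum_(i < d) u ord0 i * v ord0 i.

Definition log2 (x : R) : R := ln x / ln 2.

Definition is_gradient (f : 'rV[R]_d -> R) (gradf : 'rV[R]_d -> 'rV[R]_d) :=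
  forall x, differentiable f x /\ forall v, 'd f x v = dotp (gradf x) v.

Definition smooth_grad (beta : R) (gradf : 'rV[R]_d -> 'rV[R]_d) :=
  forall x y, enorm (gradf x - gradf y) <= beta * enorm (x - y).

(* AdaSGD, with paper indexing t = 1, 2, ...; g t is the oracle answer at step t.
   eta_t = eta / sqrt(gamma^2 + sum_{s=1}^t ||g_s||^2) *)
Definition ada_eta (eta gamma : R) (g : nat -> 'rV[R]_d) (t : nat) : R :=
  eta / Num.sqrt (gamma ^+ 2 + \sum_(1 <= s < t.+1) sqnorm (g s)).

(* ada_w n = w_n for n >= 1 (ada_w 0 = w_1 is an unused dummy);
   w_1 = w1, w_{t+1} = w_t - eta_t g_t *)
Fixpoint ada_w (eta gamma : R) (w1 : 'rV[R]_d) (g : nat -> 'rV[R]_d) (n : nat)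
  : 'rV[R]_d :=
  match n with
  | 0 => w1
  | S t => if t is 0 then w1
           else ada_w eta gamma w1 g t - ada_eta eta gamma g t *: g t
  end.

(* generators of sigma(g_1, ..., g_{t-1}) : preimages of Borel sets by the
   coordinates of g_s, 1 <= s < t *)
Definition history {T : Type} (g : nat -> T -> 'rV[R]_d) (t : nat) : set (set T) :=
  [set A | exists s (i : 'I_d) (B : set R),
      [/\ (1 <= s < t)%N, measurable B & A = (fun x => g s x ord0 i) @^-1` B]].

Definition C1 (eta gamma beta s0 s1 D1 : R) (T : nat) : R :=
  log2 (1 + (2 * s0 ^+ 2 * T%:R
             + 8 * (1 + s1 ^+ 2) * (eta ^+ 2 * beta ^+ 2 * T%:R ^+ 3 + beta * D1 * T%:R))
            / gamma ^+ 2).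

Definition Fbound (eta gamma beta s0 s1 D1 delta : R) (T : nat) : R :=
  let c1 := C1 eta gamma beta s0 s1 D1 T in
  let L := log2 (T%:R / delta) in
  2 * D1 + (3 * L + 4 * c1) * eta * s0
  + (9 * L ^+ 2 + 16 * c1 ^+ 2) * eta ^+ 2 * beta * s1 ^+ 2
  + eta ^+ 2 * beta * c1.

End Defs.

(* Main.v *)
Require Import Defs.
From HB Require Import structures.
From mathcomp Require Import all_boot all_order all_algebra.
From mathcomp Require Import all_classical all_reals all_analysis.
From mathcomp Require Import measurable_realfun ring lra.
Set Implicit Arguments. Unset Strict Implicit. Unset Printing Implicit Defensive.
Import Order.TTheory GRing.Theory Num.Theory.
Import numFieldNormedType.Exports.
Local Open Scope classical_set_scope.
Local Open Scope ring_scope.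

(* Write G_t for the AdaGrad denominator and H_t for its predictable proxy, in
   which the current squared answer |g_t|^2 is replaced by |grad|^2 + s_t^2 with
   s_t^2 = s0^2 + s1^2 |grad|^2.  The descent lemma for the step eta / G_t is
   compared with the one for eta / H_t: the bias is at most
   2 (eta / H_t) s_t |grad| |g_t| / G_t, which AM-GM splits into a fraction of
   (eta / H_t) |grad|^2 and a term proportional to |g_t|^2 / G_t^2, whose sum is
   logarithmic.  The remaining noise is a sum of bounded martingale increments,
   controlled by exp z <= z + exp (z^2) and Markov's inequality.  A strong
   induction on t then gives f (w_t) - f* <= F, since the width of the increments
   at time t only involves the earlier values.  Given this bound, dividing the
   descent inequality by eta_t and summing by parts bounds the sum of
   <grad, g_t>, and a second martingale bound turns it into the sum of |grad|^2. *)

(** * Exponential and logarithm *)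

(** The argument looks circular: the increments are controlled through [F] only while the values
    stay below [F]. The way out is to keep the random predictable sum of squared widths on the right
    of each concentration bound and to use a deterministic parameter [lam] tuned to [F]. The
    exceptional sets are then discarded before anything is known about the values, and the induction
    runs on each remaining trajectory separately, without stopping times. The size of [lam] needs no
    restriction, because the exponential inequality holds for every real z.

    The shape of [F] comes from solving a self-bounding inequality: the noise scale contains sqrt (2
    beta F), AM-GM trades it for F / 2, and all other terms together amount to at most F / 2.

    Conditional expectations never appear as such. Unbiasedness is the vanishing of the noise
    integral over every history event; it is extended to bounded predictable multipliers, and this
    orthogonality removes the linear term of the exponential inequality. *)

Lemma expR_le_quadratic (R : realType) (z : R) : z <= 1 -> expR z <= 1 + z + z ^+ 2.
Proof.
move=> z1.
(* The derivative of [h] is y (1 - y) exp (-y), so on (-oo, 1] the minimum of [h] is h 0 = 1; the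
   mean value theorem is applied on either side of 0. *)
pose h := fun y : R => (1 + y + y ^+ 2) * expR (- y).
have dh (y : R) : is_derive y 1 h (y * (1 - y) * expR (- y)).
  rewrite /h; apply: is_derive_eq.
  rewrite /GRing.scale/= ; ring.
have ch a b : {within `[a, b], continuous h}.
  apply: continuous_subspaceT => y.
  apply: differentiable_continuous; exact/derivable1_diffP.
have h0 : h 0 = 1 by rewrite /h oppr0 expR0; ring.
suff : 1 <= h z.
  by rewrite /h expRN ler_pdivlMr ?expR_gt0// mul1r.
rewrite -h0; have [z0|z0] := leP 0 z.
  have [c /[!in_itv]/= /andP[c0 cz] e] := MVT_segment z0 (fun y _ => dh y) (ch 0 z).
  rewrite -subr_ge0 e subr0; apply: mulr_ge0 => //.
  by rewrite !mulr_ge0 ?expR_ge0// subr_ge0 (le_trans cz).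
have [c /[!in_itv]/= /andP[cz c0] e] := MVT_segment (ltW z0) (fun y _ => dh y) (ch z 0).
rewrite -subr_le0 e; apply: mulr_le0_ge0; last by rewrite subr_ge0 ltW.
apply: mulr_le0_ge0; rewrite ?expR_ge0//.
by apply: mulr_le0_ge0 => //; lra.
Qed.

(** Up to z = 1 the quadratic bound combines with 1 + z^2 <= exp (z^2); beyond 1, z <= z^2 is
    enough. *)
Lemma expR_le_add_expR_sqr (R : realType) (z : R) : expR z <= z + expR (z ^+ 2).
Proof.
have q := expR_ge1Dx (z ^+ 2).
have [z1|z1] := leP z 1.
  apply: (le_trans (expR_le_quadratic z1)); lra.
have : expR z <= expR (z ^+ 2) by rewrite ler_expR expr2 ler_peMl; lra.
lra.
Qed.

(** The factor 7/10 between natural and base-2 logarithms is the slack from which the explicit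
    constants of [Fbound] are obtained. *)
Lemma ln2_le (R : realType) : ln 2 <= (7 / 10 : R).
Proof.
rewrite -[leRHS]expRK ler_ln ?posrE ?expR_gt0//.
have sq (a b x : R) : 0 <= a -> b <= a ^+ 2 -> a <= expR (x / 2) -> b <= expR x.
  move=> a0 ba ax; apply: (le_trans ba).
  have -> : expR x = expR (x / 2) ^+ 2 by rewrite -expRM_natl; congr expR; field.
  by rewrite ler_sqr// nnegrE (le_trans a0).
(* Eight halvings take the exponent from 7/10 to 7/2560, where exp x >= 1 + x suffices. The square
   of each fraction is at least the preceding one, starting from 2. *)
apply: (sq (58 / 41)); [lra|lra|].
apply: (sq (119 / 100)); [lra|lra|].
apply: (sq (12 / 11)); [lra|lra|].
apply: (sq (164 / 157)); [lra|lra|].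
apply: (sq (139 / 136)); [lra|lra|].
apply: (sq (921 / 911)); [lra|lra|].
apply: (sq (3673 / 3653)); [lra|lra|].
apply: (sq (2567 / 2560)); [lra|lra|].
apply: le_trans (expR_ge1Dx _); lra.
Qed.

Lemma ln2_gt0 (R : realType) : 0 < ln (2 : R).
Proof. by rewrite ln_gt0 ?ltr1n. Qed.

Lemma ln_log2 (R : realType) (x : R) : ln x = log2 x * ln 2.
Proof. by rewrite /log2 mulfVK// gt_eqF// ln2_gt0. Qed.

(** * Euclidean norm and smoothness *)

Section Euclid.
Variables (R : realType) (d : nat).
Implicit Types u v w : 'rV[R]_d.

Lemma sqnorm_ge0 v : 0 <= sqnorm v.
Proof. by apply: sumr_ge0 => i _; rewrite sqr_ge0. Qed.

Lemma enorm_ge0 v : 0 <= enorm v. Proof. exact: sqrtr_ge0. Qed.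

Lemma enorm_sqr v : enorm v ^+ 2 = sqnorm v.
Proof. by rewrite sqr_sqrtr// sqnorm_ge0. Qed.

Lemma dotpC u v : dotp u v = dotp v u.
Proof. by apply: eq_bigr => i _; rewrite mulrC. Qed.

Lemma dotpvv v : dotp v v = sqnorm v.
Proof. by apply: eq_bigr => i _; rewrite expr2. Qed.

Lemma dotpDr u v w : dotp u (v + w) = dotp u v + dotp u w.
Proof. by rewrite -big_split; apply: eq_bigr => i _; rewrite !mxE mulrDr. Qed.

Lemma dotpZr u v (a : R) : dotp u (a *: v) = a * dotp u v.
Proof. by rewrite mulr_sumr; apply: eq_bigr => i _; rewrite !mxE mulrCA. Qed.

Lemma dotpNr u v : dotp u (- v) = - dotp u v.
Proof. by rewrite -scaleN1r dotpZr mulN1r. Qed.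

Lemma dotpBr u v w : dotp u (v - w) = dotp u v - dotp u w.
Proof. by rewrite dotpDr dotpNr. Qed.

Lemma dotp0r u : dotp u 0 = 0.
Proof. by rewrite -(scale0r 0) dotpZr mul0r. Qed.

Lemma dotpBl u v w : dotp (u - v) w = dotp u w - dotp v w.
Proof. by rewrite dotpC dotpBr !(dotpC w). Qed.

Lemma sqnormZ (a : R) v : sqnorm (a *: v) = a ^+ 2 * sqnorm v.
Proof. by rewrite mulr_sumr; apply: eq_bigr => i _; rewrite mxE exprMn. Qed.

Lemma sqnormN v : sqnorm (- v) = sqnorm v.
Proof. by rewrite -scaleN1r sqnormZ sqrrN expr1n mul1r. Qed.

Lemma enormN v : enorm (- v) = enorm v.
Proof. by rewrite /enorm sqnormN. Qed.

Lemma enormZ (a : R) v : enorm (a *: v) = `|a| * enorm v.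
Proof. by rewrite /enorm sqnormZ sqrtrM ?sqr_ge0// sqrtr_sqr. Qed.

Lemma sqnormD u v : sqnorm (u + v) = sqnorm u + 2 * dotp u v + sqnorm v.
Proof.
rewrite /sqnorm /dotp mulr_sumr -!big_split/=; apply: eq_bigr => i _.
by rewrite mxE; ring.
Qed.

Lemma sqnormB u v : sqnorm (u - v) = sqnorm u - 2 * dotp u v + sqnorm v.
Proof. by rewrite sqnormD dotpNr sqnormN mulrN. Qed.

Lemma coord_sqr_le v (i : 'I_d) : v ord0 i ^+ 2 <= sqnorm v.
Proof.
rewrite /sqnorm (bigD1 i)//= lerDl; apply: sumr_ge0 => j _; exact: sqr_ge0.
Qed.

Lemma coord_le_enorm v (i : 'I_d) : `|v ord0 i| <= enorm v.
Proof. by rewrite -sqrtr_sqr ler_sqrt ?sqnorm_ge0// coord_sqr_le. Qed.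

Lemma sqnorm_eq0 v : sqnorm v = 0 -> v = 0.
Proof.
move=> v0; apply/rowP => i; rewrite mxE; apply/eqP.
by rewrite -sqrf_eq0 eq_le sqr_ge0 andbT -v0 coord_sqr_le.
Qed.

Lemma dotp_sqr_le u v : dotp u v ^+ 2 <= sqnorm u * sqnorm v.
Proof.
have [/sqnorm_eq0 ->|v0] := eqVneq (sqnorm v) 0.
  by rewrite dotp0r expr0n/= mulr_ge0// sqnorm_ge0.
have vp : 0 < sqnorm v by rewrite lt_def v0 sqnorm_ge0.
have := sqnorm_ge0 (sqnorm v *: u - dotp u v *: v).
rewrite sqnormB !sqnormZ dotpZr (dotpC (_ *: u)) dotpZr (dotpC v).
by move=> h; rewrite -(ler_pM2l vp) -subr_ge0; apply: le_trans h _; lra.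
Qed.

Lemma dotp_le u v : `|dotp u v| <= enorm u * enorm v.
Proof.
rewrite -sqrtr_sqr -sqrtrM ?sqnorm_ge0// ler_sqrt ?dotp_sqr_le//.
by rewrite mulr_ge0// sqnorm_ge0.
Qed.

Lemma enormD u v : enorm (u + v) <= enorm u + enorm v.
Proof.
rewrite -ler_sqr ?nnegrE ?addr_ge0 ?enorm_ge0// enorm_sqr sqnormD sqrrD.
rewrite !enorm_sqr; have := le_trans (ler_norm _) (dotp_le u v); lra.
Qed.

Lemma sqnormD_le u v : sqnorm (u + v) <= 2 * sqnorm u + 2 * sqnorm v.
Proof. have := sqnorm_ge0 (u - v); rewrite sqnormB sqnormD; lra. Qed.

Lemma coord_sum_le v : enorm v <= \sum_(i < d) `|v ord0 i|.
Proof.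
have h : 0 <= \sum_(i < d) `|v ord0 i| by apply: sumr_ge0.
rewrite -[leRHS]ger0_norm// -sqrtr_sqr ler_sqrt ?sqr_ge0//.
rewrite /sqnorm expr2 mulr_suml; apply: ler_sum => i _.
rewrite -real_normK ?num_real// expr2 ler_wpM2l//.
by rewrite (bigD1 i)//= lerDl; apply: sumr_ge0.
Qed.

End Euclid.

Section Smooth.
Variables (R : realType) (d : nat).
Variables (f : 'rV[R]_d -> R) (gradf : 'rV[R]_d -> 'rV[R]_d) (beta : R).
Hypothesis fgrad : is_gradient f gradf.
Hypothesis beta0 : 0 <= beta.
Hypothesis gradL : smooth_grad beta gradf.

Lemma smooth_descent (x v : 'rV[R]_d) :
  f (x + v) <= f x + dotp (gradf x) v + beta / 2 * sqnorm v.
Proof.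
(* [h] is f along the segment minus its linear part and the quadratic upper model; the Lipschitz
   gradient makes its derivative nonpositive on [0, 1]. *)
pose h (s : R) := f (x + s *: v) - s * dotp (gradf x) v
                  - beta / 2 * sqnorm v * s ^+ 2.
pose dh (s : R) := dotp (gradf (x + s *: v)) v - dotp (gradf x) v
                  - beta * sqnorm v * s.
have Dh (s : R) : is_derive s 1 h (dh s).
  have D1 : is_derive s (1 : R) (fun s : R => f (x + s *: v))
     (dotp (gradf (x + s *: v)) v).
    have [df E] := fgrad (x + s *: v).
    have dl : is_diff s (fun s : R => x + s *: v) (fun s : R => s *: v).
      apply: is_diff_eq.
      by apply/funext => r /=; rewrite /= add0r.
    have dc := is_diff_comp dl (differentiableP df).
    have /derivable1_diffP dd := ex_diff (is_diff_def := dc).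
    apply: DeriveDef; first exact: dd.
    by rewrite deriveE ?diff_val /= ?E ?scale1r.
  rewrite /h /dh; apply: is_derive_eq.
  by rewrite /GRing.scale/=; field.
have ch : {within `[0, 1], continuous h}.
  apply: continuous_subspaceT => y.
  apply: differentiable_continuous; apply/derivable1_diffP.
  exact: (@ex_derive _ _ _ _ _ _ _ (Dh y)).
have [c /[!in_itv]/= /andP[c0 c1] e] := MVT_segment ler01 (fun y _ => Dh y) ch.
suff : dh c <= 0.
  move: e; rewrite /h !scale1r !scale0r addr0; lra.
rewrite /dh -dotpBl subr_le0.
apply: le_trans (ler_norm _) _; apply: le_trans (dotp_le _ _) _.
apply: (le_trans (ler_wpM2r (enorm_ge0 _) (gradL _ _))).
rewrite addrC addKr enormZ ger0_norm// -enorm_sqr.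
lra.
Qed.

Variable fstar : R.
Hypothesis fstar_min : forall w, fstar <= f w.

(** A gradient step of length s cannot go below [fstar]; s = 1 / beta is the best choice in the
    descent inequality. *)
Lemma smooth_sqnorm_grad_le w : sqnorm (gradf w) <= 2 * beta * (f w - fstar).
Proof.
have key s : s * sqnorm (gradf w) * (1 - beta * s / 2) <= f w - fstar.
  have := smooth_descent w (- s *: gradf w).
  rewrite dotpZr dotpvv sqnormZ; have := fstar_min (w + - s *: gradf w).
  move=> h1 h2; have := le_trans h1 h2; lra.
have N0 := sqnorm_ge0 (gradf w).
have D0 : 0 <= f w - fstar by rewrite subr_ge0.
(* For beta = 0 there is no step 1 / beta, but [key] then holds for arbitrarily long steps, which
   forces the gradient to vanish. *)
have [b0|b0] := eqVneq beta 0.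
  rewrite b0 mulr0 mul0r leNgt; apply/negP => Np.
  have := key ((f w - fstar + 1) / sqnorm (gradf w)).
  rewrite b0 mulfVK ?gt_eqF//; lra.
have bp : 0 < beta by rewrite lt_def b0.
have := key beta^-1; rewrite mulfV// => h.
have {h} : beta * (beta^-1 * sqnorm (gradf w) * (1 - 1 / 2)) <= beta * (f w - fstar).
  by rewrite ler_pM2l.
rewrite !mulrA mulfV// ; lra.
Qed.

End Smooth.

(** * Scalar recursions *)

Section ScalarStep.
Variable R : realType.
Implicit Types (eta G H n N s p : R).

(* The stepsize [eta / H] uses a conditional proxy for [n ^+ 2] and hence does
   not depend on the current oracle answer; replacing [eta / G'] by it costs
   at most [2 * s] in the denominators. *)
Lemma decorrelated_step eta G (G' : R) H n N s p :
  0 <= eta -> 0 < G' -> 0 < H -> G' ^+ 2 = G ^+ 2 + n ^+ 2 ->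
  H ^+ 2 = G ^+ 2 + s ^+ 2 + N ^+ 2 -> `|p| <= N * n ->
  0 <= N -> 0 <= n -> 0 <= s -> N <= n + s -> n <= N + s ->
  - (eta / G' * p) <= - (13 / 20 * (eta / H * N ^+ 2)) + eta / H * (N ^+ 2 - p)
                      + 20 / 7 * (eta * s) * (n ^+ 2 / G' ^+ 2).
Proof.
move=> eta0 Gp Hp eG eH pN N0 n0 s0 Nns nNs.
have sH : s <= H.
  rewrite -ler_sqr ?nnegrE ?(ltW Hp)// eH; have := sqr_ge0 G; have := sqr_ge0 N; lra.
have NH : N <= H.
  rewrite -ler_sqr ?nnegrE ?(ltW Hp)// eH; have := sqr_ge0 G; have := sqr_ge0 s; lra.
have GH0 : 0 < G' + H by rewrite addr_gt0.
(* After multiplication by G' + H the claim concerns n^2 - s^2 - N^2, and n differs from N by at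
   most s, so this is at most 2 s N in the upper direction; downwards, the case N <= s is handled by
   s^2 + N^2 <= 2 s H. *)
have absd : `|G' - H| <= 2 * s.
  rewrite -(ler_pM2r GH0) -{1}(ger0_norm (ltW GH0)) -normrM.
  have -> : (G' - H) * (G' + H) = n ^+ 2 - s ^+ 2 - N ^+ 2.
    by rewrite -subr_sqr eG eH; ring.
  have sG : 0 <= s * G' by rewrite mulr_ge0// ltW.
  have sN : s * N <= s * H by rewrite ler_wpM2l.
  have ss : s * s <= s * H by rewrite ler_wpM2l.
  rewrite ler_norml; apply/andP; split.
    have [Ns|sN'] := leP N s; first by nra.
    have : (N - s) ^+ 2 <= n ^+ 2 by rewrite ler_sqr ?nnegrE//; lra.
    nra.
  have : n ^+ 2 <= (N + s) ^+ 2 by rewrite ler_sqr ?nnegrE//; lra.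
  nra.
pose u := eta / H; pose r := n / G'.
have u0 : 0 <= u by rewrite divr_ge0// ltW.
have r0 : 0 <= r by rewrite divr_ge0// ltW.
have us : u * s <= eta by rewrite /u mulrAC ler_pdivrMr// ler_wpM2l.
have bias : (u - eta / G') * p <= u * (2 * s * N * r).
  have -> : u - eta / G' = u * ((G' - H) / G').
    by rewrite /u; field; rewrite !gt_eqF.
  rewrite -mulrA ler_wpM2l//.
  have -> : (G' - H) / G' * p = ((G' - H) * p) / G' by rewrite mulrAC.
  rewrite /r mulrA ler_pM2r ?invr_gt0//.
  apply: le_trans (ler_norm _) _; rewrite normrM.
  by rewrite -[leRHS]mulrA; apply: ler_pM.
(* The weight 7/20 leaves 13/20 of the descent term for the martingale. The cost 20/7, multiplied by
   the 7/10 of the logarithmic bound, becomes exactly 2. *)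
have amgm : u * (2 * s * N * r) <= 7 / 20 * (u * N ^+ 2) + 20 / 7 * (u * s) * s * r ^+ 2.
  have := mulr_ge0 u0 (sqr_ge0 (7 / 20 * N - s * r)); lra.
have last1 : (u * s) * (s * r ^+ 2) <= eta * (s * r ^+ 2).
  by rewrite ler_wpM2r// mulr_ge0// sqr_ge0.
have -> : n ^+ 2 / G' ^+ 2 = r ^+ 2 by rewrite /r exprMn exprVn.
rewrite -/u.
lra.
Qed.

(** This is ln x <= x - 1 at x = G^2 / G'^2; summed over steps, the right-hand side telescopes. *)
Lemma sqr_ratio_le_ln G (G' : R) n : 0 < G -> 0 < G' -> G' ^+ 2 = G ^+ 2 + n ^+ 2 ->
  n ^+ 2 / G' ^+ 2 <= ln (G' ^+ 2) - ln (G ^+ 2).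
Proof.
move=> G0 G0' e.
have p1 : 0 < G ^+ 2 by rewrite exprn_gt0.
have p2 : 0 < G' ^+ 2 by rewrite exprn_gt0.
have -> : n ^+ 2 / G' ^+ 2 = 1 - G ^+ 2 / G' ^+ 2.
  by rewrite (_ : n ^+ 2 = G' ^+ 2 - G ^+ 2); [field; rewrite gt_eqF|lra].
have := @le_ln1Dx R (G ^+ 2 / G' ^+ 2 - 1).
rewrite (addrC 1) subrK ln_div ?posrE// => h.
have : -1 < G ^+ 2 / G' ^+ 2 - 1 by rewrite ltrBrDl subrr divr_gt0.
move=> /h; lra.
Qed.

Lemma sqr_ratio_le_diff G (G' : R) n : 0 < G -> 0 < G' -> G' ^+ 2 = G ^+ 2 + n ^+ 2 ->
  n ^+ 2 / G' <= 2 * (G' - G).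
Proof.
move=> G0 G0' e; rewrite ler_pdivrMr//.
have : 0 <= (G' - G) ^+ 2 by exact: sqr_ge0.
lra.
Qed.

End ScalarStep.

(** * One trajectory as real sequences: n = |g|, N = |grad|, s the noise level, p = <grad, g>, Dl =
    f - f* *)

Section ScalarRun.
Variables (R : realType) (beta eta s0 s1 : R) (T : nat).
Variables (G H n N s p Dl : nat -> R).
Hypotheses (beta0 : 0 <= beta) (eta0 : 0 < eta) (s00 : 0 <= s0) (s10 : 0 <= s1).
Hypothesis G0 : forall k, 0 < G k.
Hypothesis H0 : forall k, 0 < H k.
Hypothesis GS : forall k, G k.+1 ^+ 2 = G k ^+ 2 + n k ^+ 2.
Hypothesis HE : forall k, H k ^+ 2 = G k ^+ 2 + s k ^+ 2 + N k ^+ 2.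
Hypotheses (n0 : forall k, 0 <= n k) (N0 : forall k, 0 <= N k)
  (sge0 : forall k, 0 <= s k).
Hypothesis sE : forall k, s k ^+ 2 = s0 ^+ 2 + s1 ^+ 2 * N k ^+ 2.
Hypothesis pN : forall k, `|p k| <= N k * n k.
Hypothesis Dl0 : forall k, 0 <= Dl k.
Hypothesis NDl : forall k, N k ^+ 2 <= 2 * beta * Dl k.
Hypothesis DlS : forall k, Dl k.+1 <= Dl k - eta / G k.+1 * p k
  + beta / 2 * (eta ^+ 2 * (n k ^+ 2 / G k.+1 ^+ 2)).
Hypothesis noiseU : forall k, (k < T)%N -> n k <= N k + s k.
Hypothesis noiseL : forall k, (k < T)%N -> N k <= n k + s k.

Lemma std_le k : s k <= s0 + s1 * N k.
Proof.
rewrite -ler_sqr ?nnegrE ?sge0 ?addr_ge0 ?mulr_ge0// sE.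
have := mulr_ge0 s00 (mulr_ge0 s10 (N0 k)); lra.
Qed.

Lemma std_le_H k : s k <= H k.
Proof.
rewrite -ler_sqr ?nnegrE ?sge0 ?(ltW (H0 _))// HE.
by have := sqr_ge0 (G k); have := sqr_ge0 (N k); lra.
Qed.

Lemma sum_ratio_le t :
  \sum_(k < t) n k ^+ 2 / G k.+1 ^+ 2 <= ln (G t ^+ 2) - ln (G 0%N ^+ 2).
Proof.
elim: t => [|t IH]; first by rewrite big_ord0 subrr.
rewrite big_ord_recr/=; have := sqr_ratio_le_ln (G0 t) (G0 t.+1) (GS t); lra.
Qed.

Lemma sum_value_le t : (t <= T)%N ->
  Dl t <= Dl 0%N - 13 / 20 * \sum_(k < t) eta / H k * N k ^+ 2
    + \sum_(k < t) eta / H k * (N k ^+ 2 - p k)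
    + \sum_(k < t) 20 / 7 * (eta * s k) * (n k ^+ 2 / G k.+1 ^+ 2)
    + beta / 2 * eta ^+ 2 * \sum_(k < t) n k ^+ 2 / G k.+1 ^+ 2.
Proof.
elim: t => [|t IH] tT; first by rewrite !big_ord0; lra.
rewrite !big_ord_recr/=; have {}IH := IH (ltnW tT).
have := decorrelated_step (ltW eta0) (G0 t.+1) (H0 t) (GS t) (HE t) (pN t)
  (N0 t) (n0 t) (sge0 t) (noiseL tT) (noiseU tT).
have := DlS t; lra.
Qed.

(** * Bound on the function values *)

Section Values.
Variables (c1 L ell F : R).
Hypotheses (c10 : 0 <= c1) (L0 : 0 <= L).
Hypothesis FE : F = 2 * Dl 0%N + (3 * L + 4 * c1) * eta * s0
  + (9 * L ^+ 2 + 16 * c1 ^+ 2) * eta ^+ 2 * beta * s1 ^+ 2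
  + eta ^+ 2 * beta * c1.
Let B := eta * (s0 + s1 * Num.sqrt (2 * beta * F)).
Hypothesis ellL : ell <= 39 / 40 * L.
Hypothesis GT : forall t, (t <= T)%N -> ln (G t ^+ 2) - ln (G 0%N ^+ 2) <= 7 / 10 * c1.
Hypothesis conc : 0 < B -> forall t, (t <= T)%N ->
  \sum_(k < t) eta / H k * (N k ^+ 2 - p k) <=
  13 / 20 / B * \sum_(k < t) (eta / H k * (N k * s k)) ^+ 2 + ell / (13 / 20 / B).
Hypothesis incr : forall k, (k < T)%N ->
  `|eta / H k * (N k ^+ 2 - p k)| <= eta / H k * (N k * s k).

Lemma Fbound_ge0 : 0 <= F.
Proof.
rewrite FE !addr_ge0 ?mulr_ge0 ?addr_ge0 ?mulr_ge0 ?sqr_ge0 //; exact: ltW.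
Qed.

Lemma noise_scale_ge0 : 0 <= B.
Proof. by rewrite /B mulr_ge0 ?addr_ge0 ?mulr_ge0 ?sqrtr_ge0// ltW. Qed.

Lemma std_le_scale k : Dl k <= F -> eta * s k <= B.
Proof.
move=> DF; rewrite /B ler_wpM2l ?(ltW eta0)//; apply: le_trans (std_le k) _.
rewrite lerD2l ler_wpM2l// -[leLHS]ger0_norm// -sqrtr_sqr ler_sqrt ?sqr_ge0//.
  by apply: (le_trans (NDl k)); rewrite ler_wpM2l// mulr_ge0.
by rewrite !mulr_ge0// Fbound_ge0.
Qed.

(** With u = eta / H, the squared width is (u s^2) (u N^2), and s <= H makes the first factor at
    most eta s <= B. The quadratic term of [conc] is therefore at most 13/20 of the sum of u N^2,
    which is what the descent has left, and the remainder is (39/40) (20/13) L B = 3/2 L B. *)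
Lemma martingale_sum_le t : (t <= T)%N -> (forall k, (k < t)%N -> Dl k <= F) ->
  \sum_(k < t) eta / H k * (N k ^+ 2 - p k) <=
  13 / 20 * \sum_(k < t) eta / H k * N k ^+ 2 + 3 / 2 * L * B.
Proof.
move=> tT DF.
have u0 k : 0 <= eta / H k by rewrite divr_ge0 ?ltW.
have sq k : (k < t)%N -> (eta / H k * (N k * s k)) ^+ 2 <= B * (eta / H k * N k ^+ 2).
  move=> kt; have sB := std_le_scale (DF _ kt).
  have usB : eta / H k * s k * s k <= B.
    apply: le_trans sB; rewrite ler_wpM2r// mulrAC ler_pdivrMr// ler_wpM2l ?(ltW eta0)//.
    exact: std_le_H.
  have -> : (eta / H k * (N k * s k)) ^+ 2 =
    (eta / H k * s k * s k) * (eta / H k * N k ^+ 2) by ring.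
  by rewrite ler_wpM2r// mulr_ge0 ?sqr_ge0.
(* For B = 0 the parameter 13/20 / B is meaningless, but then the widths vanish and with them the
   increments. *)
have := noise_scale_ge0; rewrite le_eqVlt => /predU1P[B0|Bp].
  have S0 : 0 <= \sum_(k < t) eta / H k * N k ^+ 2.
    by apply: sumr_ge0 => k _; rewrite mulr_ge0// sqr_ge0.
  rewrite -B0 mulr0 addr0 big1; first by rewrite mulr_ge0.
  move=> k _; have := sq k (ltn_ord k); rewrite -B0 mul0r => h.
  have /eqP : (eta / H k * (N k * s k)) ^+ 2 = 0 by apply/le_anti; rewrite h sqr_ge0.
  rewrite sqrf_eq0 => /eqP h0.
  have := incr (leq_trans (ltn_ord k) tT); rewrite h0 normr_le0 => /eqP; exact.
apply: (le_trans (conc Bp tT)); apply: lerD.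
  rewrite -mulrA ler_wpM2l ?divr_ge0// ler_pdivrMl// mulr_sumr.
  by apply: ler_sum => k _; apply: sq.
by rewrite invf_div mulrA ler_pdivrMr//; have := ler_wpM2r (ltW Bp) ellL; lra.
Qed.

(** The two gradient sums cancel, leaving Dl 0 + B y + beta eta^2 c1 / 2 with y = 3/2 L + 2 c1.
    Since B contains sqrt (2 beta F), this is an inequality in F itself. The coefficients of F are
    doubled to solve it: 3 L + 4 c1 is 2 y, and 9 L^2 + 16 c1^2 bounds 2 y^2. *)
Lemma value_step t : (t <= T)%N -> (forall k, (k < t)%N -> Dl k <= F) -> Dl t <= F.
Proof.
move=> tT DF.
have h1 := sum_value_le tT.
have h2 := martingale_sum_le tT DF.
have h3 := le_trans (sum_ratio_le t) (GT tT).
have r0 k : 0 <= n k ^+ 2 / G k.+1 ^+ 2 by rewrite divr_ge0 ?sqr_ge0.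
have h4 : \sum_(k < t) 20 / 7 * (eta * s k) * (n k ^+ 2 / G k.+1 ^+ 2) <= 2 * B * c1.
  apply: (@le_trans _ _ (20 / 7 * B * \sum_(k < t) n k ^+ 2 / G k.+1 ^+ 2)).
    rewrite mulr_sumr; apply: ler_sum => k _; rewrite ler_wpM2r// ler_wpM2l//.
    by apply: std_le_scale; apply: DF.
  have B0 := noise_scale_ge0.
  have : 20 / 7 * B * \sum_(k < t) n k ^+ 2 / G k.+1 ^+ 2 <= 20 / 7 * B * (7 / 10 * c1).
    by rewrite ler_wpM2l// mulr_ge0.
  lra.
have be0 : 0 <= beta / 2 * eta ^+ 2 by rewrite mulr_ge0 ?sqr_ge0// divr_ge0.
have h5 := ler_wpM2l be0 h3.
pose q := Num.sqrt (2 * beta * F).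
have q2 : q ^+ 2 = 2 * beta * F by rewrite sqr_sqrtr// !mulr_ge0// Fbound_ge0.
have F0 := Fbound_ge0.
pose y := 3 / 2 * L + 2 * c1.
have y2 : y ^+ 2 <= 9 / 2 * L ^+ 2 + 8 * c1 ^+ 2.
  by have := sqr_ge0 (3 / 2 * L - 2 * c1); rewrite /y; lra.
have bec : 0 <= beta * eta ^+ 2 * c1 by rewrite mulr_ge0// mulr_ge0// sqr_ge0.
have cross : eta * s1 * q * y <= F / 2 + eta ^+ 2 * s1 ^+ 2 * beta * y ^+ 2.
  have [b0|b0] := eqVneq beta 0.
    have /eqP : q ^+ 2 = 0 by rewrite q2 b0; ring.
    rewrite sqrf_eq0 => /eqP ->; rewrite b0; lra.
  have bp : 0 < beta by rewrite lt_def b0.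
  (* Expanded with q^2 = 2 beta F and divided by 4 beta, this square is exactly [cross]; the
     division is why beta = 0 was treated apart. *)
  have := sqr_ge0 (q - 2 * beta * (eta * s1 * y)).
  rewrite sqrrB q2 => h.
  rewrite -(ler_pM2l bp); lra.
have e1 : 0 <= eta ^+ 2 * s1 ^+ 2 * beta by rewrite mulr_ge0// mulr_ge0// sqr_ge0.
have h6 := ler_wpM2l e1 y2.
have By : B * y = eta * s0 * y + eta * s1 * q * y by rewrite /B -/q; ring.
have : Dl t <= Dl 0%N + B * y + beta / 2 * eta ^+ 2 * c1.
  by rewrite /y; lra.
rewrite By => h7.
have h8 : eta * s0 * y = (3 / 2 * L + 2 * c1) * eta * s0 by rewrite /y; ring.
rewrite h8 in h7.
by rewrite FE in cross *; lra.
Qed.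

Lemma value_le t : (t <= T)%N -> Dl t <= F.
Proof.
elim/ltn_ind: t => t IH tT; apply: value_step => // k kt.
by apply: IH => //; apply: leq_trans tT; exact: ltnW.
Qed.

End Values.

(** * Bound on the sum of squared gradient norms *)

Section Gradients.
Variables (F ell L1 : R).
Hypotheses (F0 : 0 <= F) (ell0 : 0 <= ell) (ellL1 : ell <= 17 / 10 * L1) (L11 : 1 <= L1).
Hypothesis DF : forall k, (k <= T)%N -> Dl k <= F.
Let S2 := s0 ^+ 2 + s1 ^+ 2 * (2 * beta * F).
Let K := 2 * F / eta + eta * beta.
Hypothesis conc2 : 0 < S2 ->
  \sum_(k < T) (N k ^+ 2 - p k) <=
  (4 * S2)^-1 * \sum_(k < T) (N k * s k) ^+ 2 + ell / (4 * S2)^-1.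
Hypothesis incr2 : forall k, (k < T)%N -> `|N k ^+ 2 - p k| <= N k * s k.
Hypothesis noise2 : forall k, (k < T)%N -> n k ^+ 2 <= 2 * N k ^+ 2 + 2 * s k ^+ 2.

Lemma std_sqr_le k : (k <= T)%N -> s k ^+ 2 <= S2.
Proof.
move=> kT; rewrite sE lerD2l ler_wpM2l ?sqr_ge0//.
by apply: (le_trans (NDl k)); rewrite ler_wpM2l ?mulr_ge0// DF.
Qed.

(** The final negative term is the boundary term carried by the induction. Passing from Dl t * G t
    to Dl t * G t.+1 costs F (G t.+1 - G t) / eta, and n^2 / G t.+1 <= 2 (G t.+1 - G t) turns the
    second-order terms into a telescoping sum too. *)
Lemma abel_sum_le t : (t <= T)%N ->
  \sum_(k < t) p k <= G 0%N / eta * Dl 0%N + (F / eta + eta * beta) * (G t - G 0%N)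
     - Dl t * G t / eta.
Proof.
elim: t => [|t IH] tT.
  by rewrite big_ord0; lra.
rewrite big_ord_recr/=; have {}IH := IH (ltnW tT).
have h1 := DlS t.
have gp := G0 t.+1.
have h2 : p t <= (Dl t - Dl t.+1) * G t.+1 / eta + beta / 2 * eta * (n t ^+ 2 / G t.+1).
  have c0 : 0 <= G t.+1 / eta by rewrite divr_ge0 ?ltW.
  have h3 : G t.+1 / eta * (eta / G t.+1 * p t) <= G t.+1 / eta * (Dl t - Dl t.+1 +
    beta / 2 * (eta ^+ 2 * (n t ^+ 2 / G t.+1 ^+ 2))).
    by rewrite ler_wpM2l//; lra.
  have e1 : G t.+1 / eta * (eta / G t.+1 * p t) = p t.
    by field; rewrite !gt_eqF.
  have e2 : G t.+1 / eta * (Dl t - Dl t.+1 +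
    beta / 2 * (eta ^+ 2 * (n t ^+ 2 / G t.+1 ^+ 2))) =
    (Dl t - Dl t.+1) * G t.+1 / eta + beta / 2 * eta * (n t ^+ 2 / G t.+1).
    by field; rewrite !gt_eqF.
  by rewrite e1 e2 in h3.
have h4 := sqr_ratio_le_diff (G0 t) gp (GS t).
have h5 : beta / 2 * eta * (n t ^+ 2 / G t.+1) <= beta / 2 * eta * (2 * (G t.+1 - G t)).
  by rewrite ler_wpM2l// mulr_ge0 ?divr_ge0// ltW.
have gg : 0 <= G t.+1 - G t.
  rewrite subr_ge0 -ler_sqr ?nnegrE ?(ltW (G0 _))// GS lerDl sqr_ge0//.
have h6 : Dl t * (G t.+1 - G t) / eta <= F * (G t.+1 - G t) / eta.
  by rewrite ler_wpM2r ?invr_ge0 ?(ltW eta0)// ler_wpM2r// DF// ltnW.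
lra.
Qed.

(** Write X for the left-hand side. The growth of G up to T is itself at most of order sqrt X plus a
    noise term, so both the martingale and this growth give back X / 4. Solving for X doubles the
    remaining constants; the largest is then 13.6, for s0^2 L1, and 20 is a round upper value. *)
Lemma sum_sqr_grad_le :
  \sum_(k < T) N k ^+ 2 <= 20 * K * s0 * Num.sqrt T%:R
    + 20 * (G 0%N / eta * Dl 0%N + (1 + s1 ^+ 2 * L1) * K ^+ 2 + s0 ^+ 2 * L1).
Proof.
set X := \sum_(k < T) N k ^+ 2.
have X0 : 0 <= X by apply: sumr_ge0 => k _; rewrite sqr_ge0.
have K0 : 0 <= K by rewrite addr_ge0 ?divr_ge0 ?mulr_ge0 ?(ltW eta0).
have S20 : 0 <= S2 by rewrite addr_ge0 ?sqr_ge0// mulr_ge0 ?sqr_ge0// !mulr_ge0.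
(* The two summands of K have product 2 beta F. This inequality replaces the F inside S2 by K^2. *)
have bFK : 4 * (beta * F) <= K ^+ 2.
  have -> : K ^+ 2 = (2 * F / eta - eta * beta) ^+ 2 + 8 * (beta * F).
    by rewrite /K; field; rewrite gt_eqF.
  have := sqr_ge0 (2 * F / eta - eta * beta); have := mulr_ge0 beta0 F0; lra.
(* The squared widths N^2 s^2 are at most S2 N^2, so the parameter 1 / (4 S2) makes the quadratic
   part X / 4. *)
have mart : X - \sum_(k < T) p k <= X / 4 + 4 * S2 * ell.
  rewrite /X -sumrB; have := S20; rewrite le_eqVlt => /predU1P[S0|Sp].
    rewrite -S0 mulr0 mul0r addr0 big1 ?mulr_ge0//.
    move=> k _; have h := std_sqr_le (ltnW (ltn_ord k)).
    have /eqP : s k ^+ 2 = 0 by apply/le_anti; rewrite sqr_ge0 andbT S0.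
    rewrite sqrf_eq0 => /eqP sk; have := incr2 (ltn_ord k).
    by rewrite sk mulr0 normr_le0 => /eqP.
  apply: (le_trans (conc2 Sp)); apply: lerD; last by rewrite invrK mulrC.
  rewrite ler_pdivrMl ?mulr_gt0//.
  rewrite [leRHS](_ : _ = S2 * X); last by rewrite /X; field.
  rewrite mulr_sumr; apply: ler_sum => k _.
  by rewrite exprMn mulrC ler_wpM2r ?sqr_ge0// std_sqr_le// ltnW.
have abel : \sum_(k < T) p k <= G 0%N / eta * Dl 0%N + K * (G T - G 0%N).
  apply: (le_trans (abel_sum_le (leqnn T))).
  have gg : 0 <= G T - G 0%N.
    rewrite subr_ge0; elim: (T) => // t IH; apply: le_trans IH _.
    by rewrite -ler_sqr ?nnegrE ?(ltW (G0 _))// GS lerDl sqr_ge0.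
  have h1 : 0 <= Dl T * G T / eta by rewrite !mulr_ge0 ?invr_ge0 ?(ltW eta0) ?(ltW (G0 _)).
  have h2 : 0 <= F / eta * (G T - G 0%N) by rewrite !mulr_ge0 ?invr_ge0 ?(ltW eta0) ?(ltW (G0 _)).
  by rewrite /K; lra.
pose Y := G T - G 0%N.
have GE t : G t ^+ 2 = G 0%N ^+ 2 + \sum_(k < t) n k ^+ 2.
  elim: t => [|t IH]; first by rewrite big_ord0 addr0.
  by rewrite GS IH big_ord_recr/= addrA.
have sn : \sum_(k < T) n k ^+ 2 <= 2 * T%:R * s0 ^+ 2 + 2 * (1 + s1 ^+ 2) * X.
  apply: (@le_trans _ _ (\sum_(k < T) (2 * s0 ^+ 2 + 2 * (1 + s1 ^+ 2) * N k ^+ 2))).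
    apply: ler_sum => k _; have := noise2 (ltn_ord k); rewrite sE; lra.
  rewrite big_split/= sumr_const card_ord -mulr_sumr -/X -mulr_natr; lra.
have gg : 0 <= Y.
  have : G 0%N ^+ 2 <= G T ^+ 2.
    by rewrite (GE T) lerDl; apply: sumr_ge0 => k _; rewrite sqr_ge0.
  by rewrite /Y subr_ge0 ler_sqr ?nnegrE// ltW.
have Y2 : Y ^+ 2 <= 2 * T%:R * s0 ^+ 2 + 2 * (1 + s1 ^+ 2) * X.
  apply: le_trans sn; have -> : \sum_(k < T) n k ^+ 2 = G T ^+ 2 - G 0%N ^+ 2.
    by rewrite (GE T); ring.
  have := mulr_ge0 (ltW (G0 0%N)) gg; rewrite /Y; lra.
pose rT := Num.sqrt (T%:R : R).
have rT0 : 0 <= rT by exact: sqrtr_ge0.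
have rT2 : rT ^+ 2 = T%:R by rewrite sqr_sqrtr.
(* The square root of the bound [Y2] splits into a part in sqrt T and a part [b] in sqrt X; AM-GM on
   K b yields the second X / 4. *)
have KY : K * Y <= 2 * K * s0 * rT + X / 4 + 2 * (1 + s1 ^+ 2) * K ^+ 2.
  have A0 : 0 <= 2 * (1 + s1 ^+ 2) by have := sqr_ge0 s1; lra.
  pose a := 2 * s0 * rT; pose b := Num.sqrt (2 * (1 + s1 ^+ 2) * X).
  have a0 : 0 <= a by rewrite !mulr_ge0.
  have b0 : 0 <= b by exact: sqrtr_ge0.
  have b2 : b ^+ 2 = 2 * (1 + s1 ^+ 2) * X by rewrite sqr_sqrtr// mulr_ge0.
  have Yab : Y <= a + b.
    have ab0 := addr_ge0 a0 b0.
    rewrite -(@ler_sqr R Y) ?nnegrE//; apply: (le_trans Y2).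
    rewrite sqrrD b2 /a !exprMn rT2.
    have := mulr_ge0 a0 b0; have := mulr_ge0 (sqr_ge0 s0) (ler0n R T).
    rewrite /a; lra.
  have Kb : K * b <= X / 4 + 2 * (1 + s1 ^+ 2) * K ^+ 2.
    set A := 2 * (1 + s1 ^+ 2) in A0 b2 *.
    have Ap : 0 < A by rewrite /A; have := sqr_ge0 s1; lra.
    have := sqr_ge0 (b - 2 * A * K); rewrite sqrrB b2 => h.
    rewrite -(ler_pM2l Ap); lra.
  have := ler_wpM2l K0 Yab; rewrite /a; lra.
have L10 : 0 <= L1 by exact: le_trans ler01 L11.
have S2K : S2 <= s0 ^+ 2 + s1 ^+ 2 * K ^+ 2 / 2.
  by rewrite /S2 lerD2l; have := ler_wpM2l (sqr_ge0 s1) bFK; lra.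
have Sell : S2 * ell <= (s0 ^+ 2 + s1 ^+ 2 * K ^+ 2 / 2) * (17 / 10 * L1).
  by apply: ler_pM.
have gD : 0 <= G 0%N / eta * Dl 0%N by rewrite mulr_ge0 ?divr_ge0 ?(ltW eta0) ?(ltW (G0 _)).
have sK : 0 <= s1 ^+ 2 * K ^+ 2 by rewrite mulr_ge0 ?sqr_ge0.
have sKL : s1 ^+ 2 * K ^+ 2 <= s1 ^+ 2 * K ^+ 2 * L1 by rewrite ler_peMr.
have s0L : 0 <= s0 ^+ 2 * L1 by rewrite mulr_ge0 ?sqr_ge0.
have KsT : 0 <= K * s0 * rT by rewrite !mulr_ge0.
have KK := sqr_ge0 K.
have XX : X <= G 0%N / eta * Dl 0%N + K * Y + X / 4 + 4 * S2 * ell.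
  by move: mart abel; rewrite -/Y; lra.
rewrite -/rT; lra.
Qed.

End Gradients.
End ScalarRun.

(** * A single run *)

Section Logs.
Variable R : realType.
Implicit Types (x delta : R) (T : nat).

Lemma log2_ge0 x : 1 <= x -> 0 <= log2 x.
Proof. by move=> x1; rewrite /log2 divr_ge0 ?ln_ge0 ?ler1n. Qed.

Lemma ler_log2 x y : 0 < x -> x <= y -> log2 x <= log2 y.
Proof.
move=> x0 xy; rewrite /log2 ler_pM2r ?invr_gt0 ?ln2_gt0//.
by rewrite ler_ln ?posrE// (lt_le_trans x0).
Qed.

(** Amounts to 2^3 <= 3^2. The condition delta < 1/3 supplies x >= 3, and the lower bound 3/2 lets
    logarithms absorb additive constants. *)
Lemma log2_ge x : 3 <= x -> 3 / 2 <= log2 x.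
Proof.
move=> x3; apply: (@le_trans _ _ (log2 3)); last exact: ler_log2.
rewrite /log2 ler_pdivlMr ?ln2_gt0//.
have : ln (2 ^+ 3 : R) <= ln (3 ^+ 2) by rewrite ler_ln ?posrE ?exprn_gt0//; lra.
by rewrite !lnXn//; lra.
Qed.

Lemma ln_le_log2 x : 1 <= x -> ln x <= 7 / 10 * log2 x.
Proof.
move=> x1; rewrite ln_log2 mulrC ler_wpM2r ?log2_ge0 ?ln2_le//.
Qed.

(** The share 3/4 of delta costs only ln (4/3) <= 1/3, which fits into the gap between 7/10 and
    39/40 because the logarithm is at least 3/2. An even split would cost ln 2, too much when T /
    delta is close to 3. *)
Lemma ln_union_le T delta : (0 < T)%N -> 0 < delta -> delta < 1 / 3 ->
  ln (T%:R / (3 / 4 * delta)) <= 39 / 40 * log2 (T%:R / delta).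
Proof.
move=> T0 d0 d1.
have T1 : 1 <= T%:R :> R by rewrite ler1n.
have x3 : 3 <= T%:R / delta by rewrite ler_pdivlMr//; lra.
have x1 : 1 <= T%:R / delta by lra.
have -> : T%:R / (3 / 4 * delta) = (1 + 1 / 3) * (T%:R / delta).
  by field; rewrite gt_eqF.
rewrite lnM ?posrE; [|lra|lra].
have h := log2_ge x3; have h2 := ln_le_log2 x1.
have := @le_ln1Dx R (1 / 3); have : -1 < 1 / 3 :> R by lra.
by move=> /[swap] /[apply]; lra.
Qed.

(** The additive ln 4 <= 7/5 is below the base-2 logarithm, which is at least 3/2; hence 17/10 =
    7/10 + 1. *)
Lemma ln_quarter_le delta : 0 < delta -> delta < 1 / 3 ->
  ln (1 / (1 / 4 * delta)) <= 17 / 10 * log2 (delta^-1).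
Proof.
move=> d0 d1.
have x3 : 3 <= delta^-1 by rewrite -[delta^-1]mul1r ler_pdivlMr//; lra.
have x1 : 1 <= delta^-1 by lra.
have -> : 1 / (1 / 4 * delta) = 2 ^+ 2 * delta^-1 by field; rewrite gt_eqF.
rewrite lnM ?posrE; [|lra|lra].
rewrite lnXn//; have := ln2_le R; have := log2_ge x3; have := ln_le_log2 x1.
lra.
Qed.

End Logs.

(** The index [k] counts the answers already received. The denominator of eta_t is the value at k =
    t, whereas gradient, noise level and proxy indexed by [k] belong to time t = k + 1 and depend
    only on the first k answers. *)
Definition ada_norm (R : realType) (d : nat) (gamma : R) (g : nat -> 'rV[R]_d) (k : nat) : R :=
  Num.sqrt (gamma ^+ 2 + \sum_(1 <= s < k.+1) sqnorm (g s)).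

Definition noise_std (R : realType) (d : nat) (s0 s1 : R) (v : 'rV[R]_d) : R :=
  Num.sqrt (s0 ^+ 2 + s1 ^+ 2 * sqnorm v).

Definition pred_norm (R : realType) (d : nat) (gamma s0 s1 : R)
    (g : nat -> 'rV[R]_d) (v : 'rV[R]_d) (k : nat) : R :=
  Num.sqrt (ada_norm gamma g k ^+ 2 + noise_std s0 s1 v ^+ 2 + enorm v ^+ 2).

Section Path.
Variables (R : realType) (d : nat).
Variables (f : 'rV[R]_d -> R) (gradf : 'rV[R]_d -> 'rV[R]_d) (beta fstar : R).
Variables (eta gamma s0 s1 : R) (T : nat) (w1 : 'rV[R]_d) (g : nat -> 'rV[R]_d).
Hypotheses (beta0 : 0 <= beta) (gradL : smooth_grad beta gradf).
Hypotheses (eta0 : 0 < eta) (gamma0 : 0 < gamma).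

Local Notation w := (ada_w eta gamma w1 g).
Local Notation G := (ada_norm gamma g).
Local Notation grad k := (gradf (w k.+1)).
Local Notation std k := (noise_std s0 s1 (grad k)).
Local Notation H k := (pred_norm gamma s0 s1 g (grad k) k).

Lemma ada_norm_arg_gt0 k : 0 < gamma ^+ 2 + \sum_(1 <= s < k.+1) sqnorm (g s).
Proof.
by rewrite ltr_pwDl ?exprn_gt0//; apply: sumr_ge0 => i _; exact: sqnorm_ge0.
Qed.

Lemma ada_norm_gt0 k : 0 < G k.
Proof. by rewrite sqrtr_gt0 ada_norm_arg_gt0. Qed.

Lemma ada_norm_sqr k : G k ^+ 2 = gamma ^+ 2 + \sum_(1 <= s < k.+1) sqnorm (g s).
Proof. by rewrite sqr_sqrtr//; exact: ltW (ada_norm_arg_gt0 _). Qed.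

Lemma ada_norm0 : G 0%N = gamma.
Proof. by rewrite /ada_norm big_geq// addr0 sqrtr_sqr gtr0_norm. Qed.

Lemma ada_norm_sqrS k : G k.+1 ^+ 2 = G k ^+ 2 + enorm (g k.+1) ^+ 2.
Proof. by rewrite !ada_norm_sqr big_nat_recr//= addrA enorm_sqr. Qed.

Lemma ada_wSS k : w k.+2 = w k.+1 - (eta / G k.+1) *: g k.+1.
Proof. by []. Qed.

Lemma noise_std_sqr (v : 'rV[R]_d) : noise_std s0 s1 v ^+ 2 = s0 ^+ 2 + s1 ^+ 2 * sqnorm v.
Proof. by rewrite sqr_sqrtr// addr_ge0 ?sqr_ge0// mulr_ge0 ?sqr_ge0 ?sqnorm_ge0. Qed.

Lemma pred_norm_arg_gt0 (v : 'rV[R]_d) k :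
  0 < G k ^+ 2 + noise_std s0 s1 v ^+ 2 + enorm v ^+ 2.
Proof.
by rewrite -addrA ltr_pwDl ?exprn_gt0 ?ada_norm_gt0// addr_ge0 ?sqr_ge0.
Qed.

Lemma pred_norm_gt0 (v : 'rV[R]_d) k : 0 < pred_norm gamma s0 s1 g v k.
Proof. by rewrite sqrtr_gt0 pred_norm_arg_gt0. Qed.

Lemma pred_norm_sqr (v : 'rV[R]_d) k :
  pred_norm gamma s0 s1 g v k ^+ 2 = G k ^+ 2 + noise_std s0 s1 v ^+ 2 + enorm v ^+ 2.
Proof. by rewrite sqr_sqrtr//; exact: ltW (pred_norm_arg_gt0 _ _). Qed.

Lemma gamma_le_pred_norm (v : 'rV[R]_d) k : gamma <= pred_norm gamma s0 s1 g v k.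
Proof.
have Gg : gamma ^+ 2 <= G k ^+ 2.
  by rewrite ada_norm_sqr lerDl; apply: sumr_ge0 => i _; exact: sqnorm_ge0.
rewrite -ler_sqr ?nnegrE ?(ltW gamma0) ?(ltW (pred_norm_gt0 _ _))// pred_norm_sqr.
by apply: (le_trans Gg); rewrite -addrA lerDl addr_ge0 ?sqr_ge0.
Qed.

(** The denominator contains the current answer, so no answer can move the iterate by more than eta.
    The resulting deterministic bounds on the gradients give all integrability below, and the cubic
    term in T of [C1]. *)
Lemma ada_step_le k : enorm (w k.+2 - w k.+1) <= eta.
Proof.
rewrite ada_wSS addrAC subrr add0r enormN enormZ.
rewrite ger0_norm ?divr_ge0 ?(ltW eta0) ?(ltW (ada_norm_gt0 _))//.
rewrite mulrAC ler_pdivrMr ?ada_norm_gt0// ler_wpM2l ?(ltW eta0)//.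
rewrite -ler_sqr ?nnegrE ?enorm_ge0 ?(ltW (ada_norm_gt0 _))// ada_norm_sqrS.
by rewrite lerDr sqr_ge0.
Qed.

Lemma ada_dist_le k : enorm (w k.+1 - w1) <= k%:R * eta.
Proof.
elim: k => [|k IH]; first by rewrite subrr mul0r /enorm -(scale0r 0) sqnormZ expr0n/= mul0r sqrtr0.
have -> : w k.+2 - w1 = (w k.+2 - w k.+1) + (w k.+1 - w1) by rewrite addrA subrK.
apply: (le_trans (enormD _ _)).
rewrite -natr1 mulrDl mul1r addrC; exact: lerD IH (ada_step_le k).
Qed.

Lemma ada_grad_le k : enorm (grad k) <= enorm (gradf w1) + beta * (k%:R * eta).
Proof.
have -> : grad k = gradf w1 + (grad k - gradf w1) by rewrite addrC subrK.
apply: (le_trans (enormD _ _)); rewrite lerD2l; apply: (le_trans (gradL _ _)).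
by rewrite ler_wpM2l// ada_dist_le.
Qed.

Section Bounds.
Hypothesis fgrad : is_gradient f gradf.
Hypothesis fmin : forall w, fstar <= f w.
Hypotheses (s00 : 0 <= s0) (s10 : 0 <= s1) (T0 : (0 < T)%N).
Hypothesis noise : forall k, (k < T)%N ->
  sqnorm (g k.+1 - grad k) <= s0 ^+ 2 + s1 ^+ 2 * sqnorm (grad k).

Lemma noise_enorm k : (k < T)%N -> enorm (g k.+1 - grad k) <= std k.
Proof.
by move=> /noise h; rewrite ler_sqrt// addr_ge0 ?sqr_ge0// mulr_ge0 ?sqr_ge0 ?sqnorm_ge0.
Qed.

Lemma answer_sqr_le k : (k < T)%N ->
  enorm (g k.+1) ^+ 2 <= 2 * enorm (grad k) ^+ 2 + 2 * std k ^+ 2.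
Proof.
move=> kT; have := sqnormD_le (grad k) (g k.+1 - grad k).
rewrite addrC subrK !enorm_sqr noise_std_sqr => h; apply: (le_trans h).
by rewrite lerD2l ler_pM2l// noise.
Qed.

(** This must not rely on F, which is built from [C1]. The crude distance T eta from w1 gives
    |grad|^2 <= 4 beta D1 + 2 (eta beta T)^2; doubling, adding the noise and summing over T answers
    stays below the numerator in [C1]. *)
Lemma ln_ada_norm_le t : (t <= T)%N -> ln (G t ^+ 2) - ln (G 0%N ^+ 2) <=
  7 / 10 * C1 eta gamma beta s0 s1 (f w1 - fstar) T.
Proof.
move=> tT; set D1 := f w1 - fstar.
have D10 : 0 <= D1 by rewrite subr_ge0.
have T1 : 1 <= T%:R :> R by rewrite ler1n.
pose Q := 2 * s0 ^+ 2 * T%:R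
  + 8 * (1 + s1 ^+ 2) * (eta ^+ 2 * beta ^+ 2 * T%:R ^+ 3 + beta * D1 * T%:R).
have A0 : 0 <= 1 + s1 ^+ 2 by rewrite addr_ge0 ?sqr_ge0.
have Q0 : 0 <= Q.
  apply: addr_ge0; first by rewrite !mulr_ge0 ?sqr_ge0.
  apply: mulr_ge0; first by rewrite mulr_ge0.
  by apply: addr_ge0; rewrite !mulr_ge0 ?sqr_ge0 ?exprn_ge0 ?(ltW eta0).
have g2 : 0 < gamma ^+ 2 by rewrite exprn_gt0.
have each k : (k < T)%N -> sqnorm (g k.+1) <= Q / T%:R.
  move=> kT.
  have kT' : k%:R <= T%:R :> R by rewrite ler_nat ltnW.
  have h1 := answer_sqr_le kT; rewrite noise_std_sqr !enorm_sqr in h1.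
  have h2 : sqnorm (grad k) <= 4 * beta * D1 + 2 * (eta ^+ 2 * beta ^+ 2 * T%:R ^+ 2).
    have := sqnormD_le (gradf w1) (grad k - gradf w1).
    rewrite addrC subrK => h; apply: (le_trans h); apply: lerD.
      have := smooth_sqnorm_grad_le fgrad beta0 gradL fmin w1; rewrite -/D1; lra.
    rewrite ler_pM2l// -enorm_sqr -!exprMn.
    rewrite ler_sqr ?nnegrE ?enorm_ge0//; last by rewrite !mulr_ge0 ?(ltW eta0).
    apply: (le_trans (gradL _ _)); rewrite mulrAC mulrC (mulrC eta) ler_wpM2r//.
    apply: (le_trans (ada_dist_le k)); rewrite ler_wpM2r ?(ltW eta0)//.
  have h3 := ler_wpM2l A0 h2.
  rewrite ler_pdivlMr; last lra.
  apply: (le_trans (ler_wpM2r _ h1)); first lra.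
  have T00 : 0 <= T%:R :> R by [].
  have h4 := ler_wpM2r T00 h3.
  have h5 : 0 <= (1 + s1 ^+ 2) * (eta ^+ 2 * beta ^+ 2 * T%:R ^+ 2) * T%:R.
    by rewrite mulr_ge0// mulr_ge0// -!exprMn sqr_ge0.
  rewrite /Q exprS; lra.
have GQ : G t ^+ 2 <= gamma ^+ 2 * (1 + Q / gamma ^+ 2).
  rewrite mulrDr mulr1 mulrCA mulfV ?gt_eqF// mulr1 ada_norm_sqr lerD2l.
  rewrite big_add1/=.
  apply: (@le_trans _ _ (\sum_(0 <= k < t) Q / T%:R)).
    rewrite big_nat [leRHS]big_nat; apply: ler_sum => k /andP[_ kt].
    by apply: each; apply: leq_trans tT.
  rewrite sumr_const_nat subn0 -[leLHS]mulr_natr mulrAC ler_pdivrMr; last lra.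
  by rewrite ler_wpM2l// ler_nat.
have x1 : 1 <= 1 + Q / gamma ^+ 2 by rewrite lerDl divr_ge0// ltW.
rewrite /C1 -/D1 -/Q; apply: le_trans (ln_le_log2 x1).
rewrite ada_norm0 lerBlDl -lnM ?posrE//; last lra.
by rewrite ler_ln ?posrE ?exprn_gt0 ?ada_norm_gt0// mulr_gt0//; lra.
Qed.

Lemma ada_value_step k : f (w k.+2) - fstar <= f (w k.+1) - fstar
  - eta / G k.+1 * dotp (grad k) (g k.+1)
  + beta / 2 * (eta ^+ 2 * (enorm (g k.+1) ^+ 2 / G k.+1 ^+ 2)).
Proof.
have := smooth_descent fgrad gradL (w k.+1) (- ((eta / G k.+1) *: g k.+1)).
rewrite -ada_wSS dotpNr dotpZr sqnormN sqnormZ -enorm_sqr exprMn exprVn; lra.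
Qed.

Lemma dotp_noise k : enorm (grad k) ^+ 2 - dotp (grad k) (g k.+1) =
  dotp (grad k) (grad k - g k.+1).
Proof. by rewrite dotpBr dotpvv enorm_sqr. Qed.

Lemma dotp_noise_le k : (k < T)%N ->
  `|enorm (grad k) ^+ 2 - dotp (grad k) (g k.+1)| <= enorm (grad k) * std k.
Proof.
move=> kT; rewrite dotp_noise; apply: (le_trans (dotp_le _ _)).
by rewrite ler_wpM2l ?enorm_ge0// -enormN opprB noise_enorm.
Qed.

Variable delta : R.
Hypotheses (delta0 : 0 < delta) (delta1 : delta < 1 / 3).
Let D1 := f w1 - fstar.
Let F := Fbound eta gamma beta s0 s1 D1 delta T.
Let B := eta * (s0 + s1 * Num.sqrt (2 * beta * F)).
Let S2 := s0 ^+ 2 + s1 ^+ 2 * (2 * beta * F).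
Let K := 2 * F / eta + eta * beta.
Hypothesis conc : 0 < B -> forall t, (t <= T)%N ->
  \sum_(k < t) eta / H k * dotp (grad k) (grad k - g k.+1) <=
  13 / 20 / B * \sum_(k < t) (eta / H k * (enorm (grad k) * std k)) ^+ 2
  + ln (T%:R / (3 / 4 * delta)) / (13 / 20 / B).
Hypothesis conc2 : 0 < S2 ->
  \sum_(k < T) dotp (grad k) (grad k - g k.+1) <=
  (4 * S2)^-1 * \sum_(k < T) (enorm (grad k) * std k) ^+ 2
  + ln (1 / (1 / 4 * delta)) / (4 * S2)^-1.

(** A deterministic statement about one sequence of answers: probability enters only through
    [noise], [conc] and [conc2], which are to hold outside exceptional sets. *)
Lemma path_bounds :
  (T%:R^-1 * \sum_(1 <= t < T.+1) sqnorm (gradf (w t))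
        <= 20%:R * K * s0 / Num.sqrt T%:R
           + 20%:R * (gamma / eta * D1
                     + (1 + s1 ^+ 2 * log2 (delta^-1)) * K ^+ 2
                     + s0 ^+ 2 * log2 (delta^-1)) / T%:R)
      /\ (forall t, (1 <= t <= T.+1)%N -> f (w t) - fstar <= F).
Proof.
have T1 : 1 <= T%:R :> R by rewrite ler1n.
have d0 := delta0; have d1 := delta1.
have x1 : 1 <= T%:R / delta by rewrite ler_pdivlMr//; lra.
have x3 : 3 <= delta^-1 by rewrite -[delta^-1]mul1r ler_pdivlMr//; lra.
have D10 : 0 <= D1 by rewrite subr_ge0.
have c10 : 0 <= C1 eta gamma beta s0 s1 D1 T.
  apply: log2_ge0; rewrite lerDl divr_ge0 ?sqr_ge0//.
  apply: addr_ge0; first by rewrite !mulr_ge0 ?sqr_ge0.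
  apply: mulr_ge0; first by rewrite mulr_ge0// addr_ge0 ?sqr_ge0.
  by apply: addr_ge0; rewrite !mulr_ge0 ?sqr_ge0 ?exprn_ge0 ?(ltW eta0).
pose n k := enorm (g k.+1); pose N k := enorm (grad k); pose s k := std k.
pose p k := dotp (grad k) (g k.+1); pose Dl k := f (w k.+1) - fstar.
pose h k := H k.
have NDl k : N k ^+ 2 <= 2 * beta * Dl k.
  by rewrite enorm_sqr; exact: (smooth_sqnorm_grad_le fgrad beta0 gradL fmin).
have Dl0 k : 0 <= Dl k by rewrite subr_ge0.
have sE k : s k ^+ 2 = s0 ^+ 2 + s1 ^+ 2 * N k ^+ 2.
  by rewrite noise_std_sqr enorm_sqr.
have nU k : (k < T)%N -> n k <= N k + s k.
  move=> kT; rewrite /n -[X in enorm X](subrK (grad k)) addrC.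
  by apply: (le_trans (enormD _ _)); rewrite lerD2l noise_enorm.
have nL k : (k < T)%N -> N k <= n k + s k.
  move=> kT; have e : grad k = g k.+1 + - (g k.+1 - grad k) by rewrite opprB addrC subrK.
  rewrite /N {1}e.
  by apply: (le_trans (enormD _ _)); rewrite lerD2l enormN noise_enorm.
have incr k : (k < T)%N -> `|eta / h k * (N k ^+ 2 - p k)| <= eta / h k * (N k * s k).
  move=> kT; have u0 : 0 <= eta / h k by rewrite divr_ge0 ?(ltW eta0) ?(ltW (pred_norm_gt0 _ _)).
  by rewrite normrM ger0_norm// ler_wpM2l// dotp_noise_le.
have s_ge0 k : 0 <= s k by exact: sqrtr_ge0.
have val t : (t <= T)%N -> Dl t <= F.
  apply: (@value_le R beta eta s0 s1 T G h n N s p Dl beta0 eta0 s00 s10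
    ada_norm_gt0 (fun k => pred_norm_gt0 _ k) ada_norm_sqrS
    (fun k => pred_norm_sqr _ k) (fun k => enorm_ge0 _) (fun k => enorm_ge0 _)
    s_ge0 sE (fun k => dotp_le _ _) Dl0 NDl ada_value_step nU nL
    _ (log2 (T%:R / delta)) (ln (T%:R / (3 / 4 * delta))) F c10 (log2_ge0 x1)
    (erefl _) (ln_union_le T0 delta0 delta1) ln_ada_norm_le _ incr).
  move=> Bp u uT; have := conc Bp uT.
  by under eq_bigr do rewrite -dotp_noise.
split; last first.
  by move=> [//|t] /andP[_]; rewrite ltnS => /val.
have F0 : 0 <= F by apply: le_trans (val 0%N _).
have ell0 : 0 <= ln (1 / (1 / 4 * delta)).
  by rewrite ln_ge0// ler_pdivlMr; lra.
have L11 : 1 <= log2 (delta^-1) by have := log2_ge x3; lra.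
have c2 : 0 < S2 -> \sum_(k < T) (N k ^+ 2 - p k) <=
    (4 * S2)^-1 * \sum_(k < T) (N k * s k) ^+ 2 + ln (1 / (1 / 4 * delta)) / (4 * S2)^-1.
  by move=> /conc2; under eq_bigr do rewrite -dotp_noise.
have := @sum_sqr_grad_le R beta eta s0 s1 T G n N s p Dl beta0 eta0 s00
   ada_norm_gt0 ada_norm_sqrS sE Dl0 NDl ada_value_step
   F (ln (1 / (1 / 4 * delta))) (log2 (delta^-1)) F0 ell0
   (ln_quarter_le delta0 delta1) L11 val c2 dotp_noise_le answer_sqr_le.
rewrite ada_norm0 -/D1 -/K.
have -> : \sum_(k < T) N k ^+ 2 = \sum_(1 <= t < T.+1) sqnorm (gradf (w t)).
  by rewrite big_add1 big_mkord; apply: eq_bigr => k _; rewrite enorm_sqr.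
set X := \sum_(1 <= t < T.+1) _; set Y := (_ + _ + _) => XY.
have rp : 0 < Num.sqrt (T%:R : R) by rewrite sqrtr_gt0; lra.
have e : Num.sqrt (T%:R : R) / T%:R = (Num.sqrt T%:R)^-1.
  by rewrite -{2}(@sqr_sqrtr _ T%:R)// expr2 invfM mulrA mulfV ?mul1r// gt_eqF.
rewrite mulrC ler_pdivrMr; last lra.
rewrite mulrDl mulfVK; last by rewrite gt_eqF//; lra.
by rewrite -e mulrA mulfVK// gt_eqF//; lra.
Qed.

End Bounds.
End Path.

(** * Integration against bounded predictable functions *)

Section BoundedIntegral.
Context {dm : measure_display} {Om : measurableType dm} {R : realType}.
Variable P : probability Om R.
Implicit Types (X Y : Om -> R).

(** A class closed under sums, products and exponentials, and integrable for a probability; it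
    disposes of integrability in the supermartingale argument. *)
Definition bounded_mfun X := measurable_fun setT X /\ exists M : R, forall x, `|X x| <= M.

Lemma bounded_mfun_integrable X : bounded_mfun X -> P.-integrable setT (EFin \o X).
Proof.
move=> [mX [M XM]]; apply: measurable_bounded_integrable => //.
  by rewrite ltey_eq fin_num_measure.
exists M; split; first exact: num_real.
by move=> y My x _; apply: le_trans (ltW My).
Qed.

Lemma bounded_mfunD X Y : bounded_mfun X -> bounded_mfun Y ->
  bounded_mfun (fun x => X x + Y x).
Proof.
move=> [mX [M XM]] [mY [N YN]]; split; first exact: measurable_funD.
by exists (M + N) => x; apply: le_trans (ler_normD _ _) _; exact: lerD.
Qed.

Lemma bounded_mfunM X Y : bounded_mfun X -> bounded_mfun Y ->
  bounded_mfun (fun x => X x * Y x).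
Proof.
move=> [mX [M XM]] [mY [N YN]]; split; first exact: measurable_funM.
by exists (M * N) => x; rewrite normrM ler_pM.
Qed.

Lemma bounded_mfun_cst (r : R) : bounded_mfun (fun=> r).
Proof. by split; [exact: measurable_cst|exists `|r|]. Qed.

Lemma bounded_mfun_sum (I : Type) (r : seq I) (X : I -> Om -> R) :
  (forall i, bounded_mfun (X i)) -> bounded_mfun (fun x => \sum_(i <- r) X i x).
Proof.
move=> bX; elim: r => [|i r IH].
  by under eq_fun do rewrite big_nil; exact: bounded_mfun_cst.
by under eq_fun do rewrite big_cons; exact: bounded_mfunD.
Qed.

Lemma bounded_mfun_expR X : bounded_mfun X -> bounded_mfun (fun x => expR (X x)).
Proof.
move=> [mX [M XM]]; split; first exact: measurableT_comp.
exists (expR M) => x; rewrite ger0_norm ?expR_ge0// ler_expR.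
exact: le_trans (ler_norm _) (XM x).
Qed.

Lemma bounded_mfun_indic (A : set Om) : measurable A -> bounded_mfun (\1_A : Om -> R).
Proof.
move=> mA; split; first exact: measurable_indic.
by exists 1 => x; rewrite indicE; case: (_ \in _); rewrite ?normr1 ?normr0.
Qed.

Lemma bounded_RintegralD X Y : bounded_mfun X -> bounded_mfun Y ->
  (\int[P]_x (X x + Y x) = \int[P]_x X x + \int[P]_x Y x)%R.
Proof. by move=> bX bY; rewrite RintegralD//; exact: bounded_mfun_integrable. Qed.

Lemma bounded_RintegralZ (r : R) X : bounded_mfun X ->
  (\int[P]_x (r * X x) = r * \int[P]_x X x)%R.
Proof. by move=> bX; rewrite RintegralZl//; exact: bounded_mfun_integrable. Qed.

Lemma bounded_le_Rintegral X Y : bounded_mfun X -> bounded_mfun Y ->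
  (forall x, X x <= Y x) -> (\int[P]_x X x <= \int[P]_x Y x)%R.
Proof.
by move=> bX bY XY; apply: le_Rintegral => //; exact: bounded_mfun_integrable.
Qed.

Lemma Rintegral_probability_cst (r : R) : (\int[P]_x r = r)%R.
Proof.
rewrite Rintegral_cst// (_ : fine _ = 1) ?mulr1//.
exact: (congr1 fine (probability_setT P)).
Qed.

Lemma bounded_Rintegral_sum (I : Type) (r : seq I) (X : I -> Om -> R) :
  (forall i, bounded_mfun (X i)) ->
  (\int[P]_x (\sum_(i <- r) X i x) = \sum_(i <- r) \int[P]_x X i x)%R.
Proof.
move=> bX; elim: r => [|i r IH].
  by rewrite big_nil; under eq_Rintegral do rewrite big_nil; exact: Rintegral_probability_cst.
under eq_Rintegral do rewrite big_cons.
by rewrite bounded_RintegralD ?big_cons ?IH//; exact: bounded_mfun_sum.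
Qed.

Lemma Rintegral_indicM (A : set Om) X :
  (\int[P]_x (\1_A x * X x) = \int[P]_(x in A) X x)%R.
Proof.
rewrite [RHS]Rintegral_mkcond; apply: eq_Rintegral => x _.
by rewrite patchE indicE; case: (_ \in _); rewrite ?mul1r ?mul0r.
Qed.

End BoundedIntegral.

Section Orthogonal.
Context {dm : measure_display} {Om : measurableType dm} {R : realType}.
Variable P : probability Om R.
Variable H : set (set Om).
Hypothesis Hm : H `<=` @measurable _ Om.

Definition sub_measurable (X : Om -> R) :=
  measurable_fun (setT : set (g_sigma_algebraType H)) (X : g_sigma_algebraType H -> R).

Lemma g_sigma_sub_measurable (A : set Om) : <<s H >> A -> measurable A.
Proof. exact: smallest_sub (sigma_algebra_measurable Om) Hm A. Qed.

Lemma sub_measurable_measurable X : sub_measurable X -> measurable_fun setT X.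
Proof.
move=> mX _ B mB; rewrite setTI; apply: g_sigma_sub_measurable.
by have := mX measurableT B mB; rewrite setTI.
Qed.

Variable xi : Om -> R.
Hypothesis bxi : bounded_mfun xi.
Hypothesis xi0 : forall A, <<s H >> A -> (\int[P]_(x in A) xi x = 0)%R.

(* Subtracting [b/2] on [{b/2 <= Phi}] halves the range of [Phi] without
   changing the integral. *)
Lemma integral_halving_le (M : R) n (b : R) Phi : (forall x, `|xi x| <= M) -> 0 <= b -> sub_measurable Phi ->
  (forall x, 0 <= Phi x <= b) -> `|\int[P]_x (Phi x * xi x)|%R <= b * M / 2 ^+ n.
Proof.
move=> xiM; elim: n b Phi => [|n IH] b Phi b0 mPhi Phib.
  have bP : bounded_mfun Phi.
    split; first exact: sub_measurable_measurable.
    by exists b => x; have /andP[p0 pb] := Phib x; rewrite ger0_norm.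
  have bPx := bounded_mfunM bP bxi.
  rewrite expr0 divr1; apply: le_trans.
    apply: le_normr_Rintegral => //; exact: bounded_mfun_integrable.
  rewrite -[leRHS](Rintegral_probability_cst P); apply: bounded_le_Rintegral.
  - split; first by apply: measurableT_comp => //; exact: bPx.1.
    by have [_ [C hC]] := bPx; exists C => x; rewrite normr_id.
  - exact: bounded_mfun_cst.
  - move=> x; have /andP[p0 pb] := Phib x.
    by rewrite normrM (ger0_norm p0) ler_pM.
pose A := [set x | b / 2 <= Phi x].
have mA : <<s H >> A.
  have := mPhi measurableT `[b / 2, +oo[%classic (measurable_itv _).
  rewrite setTI; congr (<<s H >> _); apply/seteqP; split => x /=.
    by rewrite in_itv/= andbT.
  by rewrite in_itv/= andbT.
pose Phi' x := Phi x + - (b / 2) * \1_A x.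
have mPhi' : sub_measurable Phi'.
  by apply: measurable_funD => //; apply: measurable_funM => //; exact: measurable_indic.
have b20 : 0 <= b / 2 by rewrite divr_ge0.
have Phib' x : 0 <= Phi' x <= b / 2.
  have /andP[p0 pb] := Phib x; rewrite /Phi' indicE.
  case: (boolP (x \in A)) => [/set_mem/= h|/negP h].
    by rewrite /A/= in h; rewrite mulr1; apply/andP; split; lra.
  have : Phi x < b / 2 by rewrite ltNge; apply/negP => h'; apply: h; exact: mem_set.
  by move=> h2; rewrite mulr0; apply/andP; split; lra.
have bP' : bounded_mfun Phi'.
  split; first exact: sub_measurable_measurable.
  by exists (b / 2) => x; have /andP[p0 pb] := Phib' x; rewrite ger0_norm.
have -> : (\int[P]_x (Phi x * xi x) = \int[P]_x (Phi' x * xi x))%R.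
  have bA := bounded_mfunM (bounded_mfun_indic (R:=R) (g_sigma_sub_measurable mA)) bxi.
  transitivity (\int[P]_x (Phi' x * xi x + b / 2 * (\1_A x * xi x)))%R.
    by apply: eq_Rintegral => x _; rewrite /Phi'; ring.
  rewrite bounded_RintegralD; [|exact: bounded_mfunM|].
    rewrite (bounded_RintegralZ _ _ bA) Rintegral_indicM xi0// mulr0 addr0//.
  by apply: bounded_mfunM => //; exact: bounded_mfun_cst.
apply: (le_trans (IH _ _ b20 mPhi' Phib')).
by rewrite exprS invfM; lra.
Qed.

(** Adding b makes [Phi] range in [0, 2 b] and leaves the integral unchanged, the whole space being
    a set of the generated sigma-algebra. The halving bound then tends to 0 in n, so no
    approximation by simple functions is needed. *)
Lemma orthogonal_of_set_integrals Phi : sub_measurable Phi ->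
  (exists b : R, forall x, `|Phi x| <= b) -> (\int[P]_x (Phi x * xi x) = 0)%R.
Proof.
move=> mPhi [b Phib].
have b0 : 0 <= b by apply: le_trans (Phib point).
have [M xiM] := bxi.2.
have M0 : 0 <= M by apply: le_trans (xiM point).
have bP : bounded_mfun Phi by split; [exact: sub_measurable_measurable|exists b].
have e : (\int[P]_x (Phi x * xi x) = \int[P]_x ((Phi x + b) * xi x))%R.
  transitivity (\int[P]_x (Phi x * xi x + b * xi x))%R; last first.
    by apply: eq_Rintegral => x _; rewrite mulrDl.
  rewrite bounded_RintegralD; [|exact: bounded_mfunM|].
    rewrite (bounded_RintegralZ _ _ bxi).
    by rewrite (xi0 (@measurableT _ (g_sigma_algebraType H))) mulr0 addr0.
  by apply: bounded_mfunM => //; exact: bounded_mfun_cst.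
have key n := @integral_halving_le M n (2 * b) (fun x => Phi x + b) xiM.
have {}key n : `|\int[P]_x (Phi x * xi x)|%R <= 2 * b * M / 2 ^+ n.
  rewrite e; apply: key; first by rewrite mulr_ge0.
    by apply: measurable_funD.
  by move=> x; have := Phib x; rewrite ler_norml => /andP[? ?]; apply/andP; split; lra.
apply/eqP; rewrite -normr_le0 leNgt; apply/negP => ap.
set a := `|_| in ap key.
have [n hn] : exists n : nat, 2 * b * M / a < n%:R.
  exists (Num.bound (2 * b * M / a)); apply: archi_boundP.
  by rewrite divr_ge0 ?mulr_ge0// ltW.
have n2 : n%:R <= 2 ^+ n :> R by rewrite -natrX ler_nat ltnW// ltn_expl.
have := key n; rewrite ler_pdivlMr ?exprn_gt0// mulrC => h.
move: hn; rewrite ltr_pdivrMr// => hn.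
have := le_lt_trans h hn; rewrite ltr_pM2r// ltNge n2//.
Qed.

End Orthogonal.

(** * Exponential supermartingale *)

Section Concentration.
Context {dm : measure_display} {Om : measurableType dm} {R : realType}.
Variable P : probability Om R.
Variables (T : nat) (H : nat -> set (set Om)) (Z D : nat -> Om -> R).
Hypothesis Hm : forall k, (k < T)%N -> H k `<=` @measurable _ Om.
Hypothesis ZH : forall j k, (j < k)%N -> (k < T)%N -> sub_measurable (H k) (Z j).
Hypothesis DH : forall j k, (j <= k)%N -> (k < T)%N -> sub_measurable (H k) (D j).
Hypothesis Zm : forall k, (k < T)%N -> measurable_fun setT (Z k).
Hypothesis ZD : forall k x, (k < T)%N -> `|Z k x| <= D k x.
Hypothesis Db : forall k, (k < T)%N -> exists M : R, forall x, D k x <= M.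
Hypothesis Z0 : forall k Phi, (k < T)%N -> sub_measurable (H k) Phi ->
  (exists b : R, forall x, `|Phi x| <= b) -> (\int[P]_x (Phi x * Z k x) = 0)%R.

Lemma bounded_mfun_incr k : (k < T)%N -> bounded_mfun (Z k).
Proof.
move=> kT; split; first exact: Zm.
by have [M DM] := Db kT; exists M => x; apply: le_trans (ZD _ kT) (DM x).
Qed.

Lemma bounded_mfun_width k : (k < T)%N -> bounded_mfun (D k).
Proof.
move=> kT; split; first by apply: (sub_measurable_measurable (Hm kT)); exact: DH.
have [M DM] := Db kT; exists M => x; rewrite ger0_norm//.
exact: le_trans (ZD x kT).
Qed.

Variable lam : R.

(** Exponent of a supermartingale: the compensator lam^2 D^2 is predictable, while Z is only
    adapted. *)
Definition log_exp_mart t x := \sum_(k < t) (lam * Z k x - lam ^+ 2 * D k x ^+ 2).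

Lemma bounded_mfun_log_exp_mart t : (t <= T)%N -> bounded_mfun (log_exp_mart t).
Proof.
move=> tT; apply: (@bounded_mfun_sum _ _ _ _ _
  (fun (k : 'I_t) x => lam * Z k x - lam ^+ 2 * D k x ^+ 2)) => k.
have kT := leq_trans (ltn_ord k) tT.
have bZ := bounded_mfun_incr kT; have bD := bounded_mfun_width kT.
apply: (@bounded_mfunD _ _ _ (fun x => lam * Z k x) (fun x => - (lam ^+ 2 * D k x ^+ 2))).
  by apply: bounded_mfunM => //; exact: bounded_mfun_cst.
under eq_fun do rewrite -mulNr expr2.
by apply: bounded_mfunM; [exact: bounded_mfun_cst|exact: bounded_mfunM].
Qed.

Lemma sub_measurable_log_exp_mart t : (t < T)%N -> sub_measurable (H t) (log_exp_mart t).
Proof.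
move=> tT; rewrite /sub_measurable /log_exp_mart.
apply: (@measurable_sum _ (g_sigma_algebraType (H t)) R setT _ (index_enum 'I_t)
  (fun k x => lam * Z k x - lam ^+ 2 * D k x ^+ 2)) => k.
apply: measurable_funB; apply: measurable_funM => //.
  exact: ZH.
by apply: measurable_funX; apply: DH => //; exact: ltnW.
Qed.

(** The exponential inequality gives, pointwise, exp S_{t+1} <= exp S_t + Phi Z_t with [Phi] bounded
    and measurable for [H t]; orthogonality removes the last term, so the integrals do not
    increase. *)
Lemma integral_exp_mart_le1 t : (t <= T)%N -> (\int[P]_x expR (log_exp_mart t x) <= 1)%R.
Proof.
elim: t => [_|t IH tT].
  under eq_Rintegral do rewrite /log_exp_mart big_ord0 expR0.
  by rewrite Rintegral_probability_cst.
have {}IH := IH (ltnW tT).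
have bS := bounded_mfun_log_exp_mart (ltnW tT).
have bZ := bounded_mfun_incr tT; have bD := bounded_mfun_width tT.
pose Phi x := lam * expR (log_exp_mart t x - lam ^+ 2 * D t x ^+ 2).
have mPhi : sub_measurable (H t) Phi.
  apply: measurable_funM => //.
  apply: (@measurableT_comp _ _ _ (g_sigma_algebraType (H t)) _ _ (@expR R)) => //.
  apply: measurable_funB; first exact: sub_measurable_log_exp_mart.
  apply: measurable_funM => //.
  by apply: measurable_funX; exact: DH.
have bPhi : bounded_mfun Phi.
  apply: bounded_mfunM; first exact: bounded_mfun_cst.
  apply: bounded_mfun_expR; apply: bounded_mfunD => //.
  under eq_fun do rewrite -mulNr expr2.
  by apply: bounded_mfunM; [exact: bounded_mfun_cst|exact: bounded_mfunM].
apply: le_trans IH.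
have -> : (\int[P]_x expR (log_exp_mart t x) =
  \int[P]_x (expR (log_exp_mart t x) + Phi x * Z t x))%R.
  rewrite bounded_RintegralD; [|exact: bounded_mfun_expR|exact: bounded_mfunM].
  by rewrite (Z0 tT mPhi bPhi.2) addr0.
apply: bounded_le_Rintegral.
- exact/bounded_mfun_expR/bounded_mfun_log_exp_mart.
- by apply: bounded_mfunD; [exact: bounded_mfun_expR|exact: bounded_mfunM].
move=> x; rewrite /log_exp_mart big_ord_recr/= -/(log_exp_mart t x) /Phi.
set S := log_exp_mart t x; set z := Z t x; set w := D t x.
have zw : z ^+ 2 <= w ^+ 2.
  rewrite -(real_normK (num_real z)) ler_sqr ?nnegrE ?ZD//.
  exact: le_trans (ZD x tT).
have e1 : expR (lam * z) <= lam * z + expR (lam ^+ 2 * w ^+ 2).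
  apply: (le_trans (expR_le_add_expR_sqr _)); rewrite lerD2l ler_expR exprMn.
  by rewrite ler_wpM2l ?sqr_ge0.
have -> : S + (lam * z - lam ^+ 2 * w ^+ 2) = (S - lam ^+ 2 * w ^+ 2) + lam * z by ring.
have eS : expR S = expR (S - lam ^+ 2 * w ^+ 2) * expR (lam ^+ 2 * w ^+ 2).
  by rewrite -expRD subrK.
rewrite expRD eS; have := ler_wpM2l (expR_ge0 (S - lam ^+ 2 * w ^+ 2)) e1; lra.
Qed.

(** Multiplied by [lam], the event says that [log_exp_mart] exceeds [ell], and Markov's inequality
    applies to its exponential. *)
Lemma martingale_tail t ell : 0 < lam -> (t <= T)%N ->
  let A := [set x | lam * \sum_(k < t) D k x ^+ 2 + ell / lam < \sum_(k < t) Z k x] in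
  measurable A /\ (P A <= (expR (- ell))%:E)%E.
Proof.
move=> lam0 tT A.
have AE : A = [set x | ell < log_exp_mart t x].
  apply/seteqP; split => x; rewrite /A /log_exp_mart /= sumrB -!mulr_sumr;
    set SZ := \sum_(k < t) Z k x; set SD := \sum_(k < t) D k x ^+ 2 => h.
    have : lam * (lam * SD + ell / lam) < lam * SZ by rewrite ltr_pM2l.
    have -> : lam * (lam * SD + ell / lam) = lam ^+ 2 * SD + ell.
      by field; rewrite gt_eqF.
    lra.
  rewrite -(ltr_pM2l lam0).
  have -> : lam * (lam * SD + ell / lam) = lam ^+ 2 * SD + ell.
    by field; rewrite gt_eqF.
  lra.
have bS := bounded_mfun_log_exp_mart tT.
have mA : measurable A.
  have := bS.1 measurableT `]ell, +oo[%classic (measurable_itv _).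
  rewrite setTI AE; congr (measurable _); apply/seteqP; split => x /=;
    by rewrite in_itv/= andbT.
split => //.
have bA := bounded_mfun_indic (R:=R) mA.
have h1 : (\int[P]_x (expR ell * \1_A x) <= \int[P]_x expR (log_exp_mart t x))%R.
  apply: bounded_le_Rintegral.
  - by apply: bounded_mfunM => //; exact: bounded_mfun_cst.
  - exact: bounded_mfun_expR.
  move=> x; rewrite indicE; case: (boolP (x \in A)) => [/set_mem|_]; last first.
    by rewrite mulr0 expR_ge0.
  by rewrite AE/= mulr1 ler_expR => /ltW.
rewrite bounded_RintegralZ// in h1.
have h2 := le_trans h1 (integral_exp_mart_le1 tT).
have e : (\int[P]_x (\1_A x : R))%R = fine (P A).
  by rewrite /Rintegral integral_indic// setIT.
rewrite e in h2.
rewrite -(fineK (fin_num_measure P A mA)) lee_fin expRN.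
by rewrite -[leRHS]mul1r ler_pdivlMr ?expR_gt0// mulrC.
Qed.

End Concentration.

(** * Measurability of the iterates *)

Section VectorMeasurable.
Context {dm : measure_display} {Om : measurableType dm} {R : realType} {d : nat}.
Implicit Types (u v : Om -> 'rV[R]_d) (a : Om -> R).

(** The measurable structure on [Om] is left generic so that each lemma serves twice: for the
    ambient sigma-algebra, and for the one generated by a history. *)
Definition coord_measurable v := forall i, measurable_fun setT (fun x => v x ord0 i).

Lemma coord_measurable_cst (c : 'rV[R]_d) : coord_measurable (fun=> c).
Proof. by move=> i; exact: measurable_cst. Qed.

Lemma coord_measurableB u v : coord_measurable u -> coord_measurable v ->
  coord_measurable (fun x => u x - v x).
Proof.
by move=> mu mv i; under eq_fun do rewrite !mxE; exact: measurable_funB.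
Qed.

Lemma coord_measurableZ a v : measurable_fun setT a -> coord_measurable v ->
  coord_measurable (fun x => a x *: v x).
Proof.
by move=> ma mv i; under eq_fun do rewrite mxE; exact: measurable_funM.
Qed.

Lemma measurable_dotp u v : coord_measurable u -> coord_measurable v ->
  measurable_fun setT (fun x => dotp (u x) (v x)).
Proof.
move=> mu mv; apply: (@measurable_sum _ _ _ _ _ _ (fun i x => u x ord0 i * v x ord0 i)) => i.
exact: measurable_funM.
Qed.

Lemma measurable_sqnorm v : coord_measurable v ->
  measurable_fun setT (fun x => sqnorm (v x)).
Proof. by move=> mv; under eq_fun do rewrite -dotpvv; exact: measurable_dotp. Qed.

Lemma measurable_sqrt a : measurable_fun setT a ->
  measurable_fun setT (fun x => Num.sqrt (a x)).
Proof.
move=> ma; apply: (@measurableT_comp _ _ _ _ _ _ (@Num.sqrt R)) => //.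
by apply: continuous_measurable_fun; exact: sqrt_continuous.
Qed.

Lemma measurable_enorm v : coord_measurable v ->
  measurable_fun setT (fun x => enorm (v x)).
Proof. by move=> mv; apply: measurable_sqrt; exact: measurable_sqnorm. Qed.

Lemma measurable_div (c : R) a : measurable_fun setT a -> (forall x, 0 < a x) ->
  measurable_fun setT (fun x => c / a x).
Proof.
move=> ma a0.
have -> : (fun x => c / a x) = (fun x => c * expR (- ln (a x))).
  by apply/funext => x; rewrite expRN lnK// posrE.
apply: measurable_funM => //; apply: measurableT_comp => //.
by apply: measurable_funN; apply: measurableT_comp => //; exact: measurable_ln.
Qed.

Lemma rat_dense_enorm (y : 'rV[R]_d) (e : R) : 0 < e ->
  exists q : 'rV[rat]_d, enorm (y - map_mx ratr q) < e.
Proof.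
(* Dividing by d + 1 keeps the total error strictly below e and also covers d = 0. *)
move=> e0; pose e' := e / d.+1%:R.
have e'0 : 0 < e' by rewrite divr_gt0.
have /choice[q hq] : forall i : 'I_d, exists r : rat, `|y ord0 i - ratr r| < e'.
  move=> i; have : y ord0 i - e' < y ord0 i + e' by lra.
  move=> /rat_in_itvoo[r]; rewrite in_itv/= => /andP[h1 h2].
  by exists r; rewrite ltr_norml; apply/andP; split; lra.
exists (\row_i q i); apply: (le_lt_trans (coord_sum_le _)).
apply: (@le_lt_trans _ _ (\sum_(i < d) e')).
  by apply: ler_sum => i _; rewrite !mxE ltW.
rewrite sumr_const card_ord -mulr_natr /e' mulrAC ltr_pdivrMr//.
by rewrite ltr_pM2l// ltr_nat.
Qed.

(** A Lipschitz h is the infimum over rational q of h q + c |. - q|, so each sublevel set is a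
    countable union of sets described by norms. This derives measurability from the coordinates
    alone. *)
Lemma measurable_lipschitz_comp (h : 'rV[R]_d -> R) (c : R) v : 0 <= c ->
  (forall y z, h y - h z <= c * enorm (y - z)) -> coord_measurable v ->
  measurable_fun setT (h \o v).
Proof.
move=> c0 hL mv _; apply: (measurability _ (RGenInftyO.measurableE R)) => //.
move=> _ [_ [a ->] <-]; rewrite setTI.
pose Q (q : 'rV[rat]_d) : 'rV[R]_d := map_mx ratr q.
rewrite [X in measurable X](_ : _ =
  \bigcup_(q : 'rV[rat]_d) [set x | h (Q q) + c * enorm (v x - Q q) < a]).
  apply: countable_bigcupT_measurable; first exact: countableP.
  move=> q.
  have m : measurable_fun setT (fun x => h (Q q) + c * enorm (v x - Q q)).
    apply: measurable_funD => //; apply: measurable_funM => //.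
    by apply: measurable_enorm; apply: coord_measurableB => //; exact: coord_measurable_cst.
  have := m measurableT `]-oo, a[%classic (measurable_itv _).
  rewrite setTI; congr (measurable _); apply/seteqP; split => x /=;
    by rewrite in_itv/=.
apply/seteqP; split => x /=; rewrite in_itv/=.
  move=> hxa.
  (* At such q the candidate value is at most h (v x) + 2 c |v x - q| < a; c + 1 avoids a division
     by zero. *)
  have [|q hq] := @rat_dense_enorm (v x) ((a - h (v x)) / (2 * (c + 1))).
    by rewrite divr_gt0//; lra.
  exists q => //=; have := hL (Q q) (v x); rewrite -enormN opprB.
  rewrite -/(Q q) in hq; set N := enorm (v x - Q q) in hq *.
  rewrite ltr_pdivlMr in hq; last lra.
  have N0 : 0 <= N by exact: enorm_ge0.
  lra.
move=> [q _]/=; have := hL (v x) (Q q); lra.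
Qed.

End VectorMeasurable.

Section AdaMeasurable.
Context {dm : measure_display} {Om : measurableType dm} {R : realType} {d : nat}.
Variables (gradf : 'rV[R]_d -> 'rV[R]_d) (beta eta gamma s0 s1 : R) (w1 : 'rV[R]_d).
Variables (g : nat -> Om -> 'rV[R]_d) (k : nat).
Hypotheses (beta0 : 0 <= beta) (gradL : smooth_grad beta gradf) (gamma0 : 0 < gamma).
Hypothesis mg : forall s, (1 <= s <= k)%N -> coord_measurable (g s).

Lemma measurable_ada_norm j : (j <= k)%N ->
  measurable_fun setT (fun x => ada_norm gamma (g^~ x) j).
Proof.
move=> jk; apply: measurable_sqrt; apply: measurable_funD => //.
under eq_fun do rewrite big_add1/= big_mkord.
apply: (@measurable_sum _ _ _ _ _ _ (fun (i : 'I_j) x => sqnorm (g i.+1 x))) => i.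
by apply: measurable_sqnorm; apply: mg; rewrite /= (leq_trans (ltn_ord i)).
Qed.

Lemma measurable_ada_w : coord_measurable (fun x => ada_w eta gamma w1 (g^~ x) k.+1).
Proof.
suff : forall j, (j <= k)%N -> coord_measurable (fun x => ada_w eta gamma w1 (g^~ x) j.+1).
  by apply.
elim=> [_|j IH jk]; first exact: coord_measurable_cst.
apply: (@coord_measurableB _ _ _ _ (fun x => ada_w eta gamma w1 (g^~ x) j.+1)
  (fun x => (eta / ada_norm gamma (g^~ x) j.+1) *: g j.+1 x)).
  exact/IH/ltnW.
apply: coord_measurableZ; last exact: mg.
by apply: measurable_div; [exact: measurable_ada_norm|move=> x; exact: ada_norm_gt0].
Qed.

Lemma measurable_ada_grad :
  coord_measurable (fun x => gradf (ada_w eta gamma w1 (g^~ x) k.+1)).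
Proof.
move=> i; apply: (@measurable_lipschitz_comp _ _ _ _ (fun y => gradf y ord0 i) beta) => //.
- move=> y z; have -> : gradf y ord0 i - gradf z ord0 i = (gradf y - gradf z) ord0 i.
    by rewrite !mxE.
  exact: le_trans (ler_norm _) (le_trans (coord_le_enorm _ _) (gradL _ _)).
- exact: measurable_ada_w.
Qed.

Lemma measurable_noise_std :
  measurable_fun setT (fun x => noise_std s0 s1 (gradf (ada_w eta gamma w1 (g^~ x) k.+1))).
Proof.
apply: measurable_sqrt; apply: measurable_funD => //; apply: measurable_funM => //.
exact/measurable_sqnorm/measurable_ada_grad.
Qed.

Lemma measurable_pred_step : measurable_fun setT
  (fun x => eta / pred_norm gamma s0 s1 (g^~ x) (gradf (ada_w eta gamma w1 (g^~ x) k.+1)) k).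
Proof.
apply: measurable_div; last by move=> x; exact: pred_norm_gt0.
apply: measurable_sqrt; apply: measurable_funD; first apply: measurable_funD.
- by apply: measurable_funX; exact: measurable_ada_norm.
- by apply: measurable_funX; exact: measurable_noise_std.
- by apply: measurable_funX; apply: measurable_enorm; exact: measurable_ada_grad.
Qed.

End AdaMeasurable.

(** * The stochastic run *)

(* Equal to [v - u] almost surely along the run; the clipping makes the noise
   bound hold everywhere. *)
Definition clipped_noise (R : realType) (d : nat) (s0 s1 : R) (v u : 'rV[R]_d) : 'rV[R]_d :=
  if sqnorm (u - v) <= s0 ^+ 2 + s1 ^+ 2 * sqnorm v then v - u else 0.

Section ClippedNoise.
Context {R : realType} {d : nat} (s0 s1 : R).
Implicit Types u v : 'rV[R]_d.

Lemma clipped_noiseE v u : sqnorm (u - v) <= s0 ^+ 2 + s1 ^+ 2 * sqnorm v ->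
  clipped_noise s0 s1 v u = v - u.
Proof. by rewrite /clipped_noise => ->. Qed.

Lemma enorm_clipped_noise_le v u : enorm (clipped_noise s0 s1 v u) <= noise_std s0 s1 v.
Proof.
rewrite /clipped_noise; case: ifP => [h|_].
  by rewrite -enormN opprB ler_sqrt// (le_trans _ h)// sqnorm_ge0.
by rewrite /enorm -(scale0r 0) sqnormZ expr0n/= mul0r sqrtr0 sqrtr_ge0.
Qed.

Lemma coord_measurable_clipped_noise {dm : measure_display} {Om : measurableType dm}
    (v u : Om -> 'rV[R]_d) : coord_measurable v -> coord_measurable u ->
  coord_measurable (fun x => clipped_noise s0 s1 (v x) (u x)).
Proof.
move=> mv mu i; rewrite /clipped_noise.
under eq_fun do rewrite (fun_if (fun z : 'rV[R]_d => z ord0 i)).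
apply: measurable_fun_ifT.
- apply: measurable_fun_ler; first exact/measurable_sqnorm/coord_measurableB.
  apply: measurable_funD => //; apply: measurable_funM => //; exact: measurable_sqnorm.
- exact: coord_measurableB.
- exact: coord_measurable_cst.
Qed.

End ClippedNoise.

Section Run.
Context {R : realType} {d : nat} {dm : measure_display} {Om : measurableType dm}.
Variables (P : probability Om R) (gradf : 'rV[R]_d -> 'rV[R]_d).
Variables (beta eta gamma s0 s1 : R) (T : nat) (w1 : 'rV[R]_d) (g : nat -> Om -> 'rV[R]_d).
Hypotheses (beta0 : 0 <= beta) (gradL : smooth_grad beta gradf).
Hypotheses (eta0 : 0 < eta) (gamma0 : 0 < gamma).
Hypothesis mg : forall t (i : 'I_d), (1 <= t <= T)%N ->
  measurable_fun setT (fun x => g t x ord0 i).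
Hypothesis unbiased : forall t (i : 'I_d) (A : set Om), (1 <= t <= T)%N ->
  <<s history g t >> A ->
  (\int[P]_(x in A) (g t x ord0 i)%:E =
   \int[P]_(x in A) (gradf (ada_w eta gamma w1 (g^~ x) t) ord0 i)%:E)%E.
Hypothesis noise : forall t, (1 <= t <= T)%N ->
  \forall x \ae P, sqnorm (g t x - gradf (ada_w eta gamma w1 (g^~ x) t))
    <= s0 ^+ 2 + s1 ^+ 2 * sqnorm (gradf (ada_w eta gamma w1 (g^~ x) t)).

Let grad k x := gradf (ada_w eta gamma w1 (g^~ x) k.+1).
Let std k x := noise_std s0 s1 (grad k x).
Let xi k x := clipped_noise s0 s1 (grad k x) (g k.+1 x).
Let hist k := history g k.+1.

Lemma history_measurable k : (k < T)%N -> hist k `<=` @measurable _ Om.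
Proof.
move=> kT _ [s [i [B [/andP[s1' sk] mB ->]]]].
have := @mg s i; rewrite s1' (ltnW (leq_trans sk kT)) => /(_ isT) /(_ measurableT _ mB).
by rewrite setTI.
Qed.

Lemma history_answer k s : (1 <= s <= k)%N ->
  @coord_measurable _ (g_sigma_algebraType (hist k)) R d (g s).
Proof.
move=> /andP[s1' sk] i _ B mB; rewrite setTI; apply: sub_sigma_algebra.
by exists s, i, B; split; rewrite ?s1' ?ltnS.
Qed.

Lemma history_le j k s : (j <= k)%N -> (1 <= s <= j)%N ->
  @coord_measurable _ (g_sigma_algebraType (hist k)) R d (g s).
Proof.
by move=> jk /andP[s1' sj]; apply: history_answer; rewrite s1' (leq_trans sj).
Qed.

Lemma measurable_answer k s : (k <= T)%N -> (1 <= s <= k)%N -> coord_measurable (g s).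
Proof.
by move=> kT /andP[s1' sk] i; apply: mg; rewrite s1' (leq_trans sk).
Qed.

Lemma measurable_grad k : (k < T)%N -> coord_measurable (grad k).
Proof.
move=> kT; apply: (measurable_ada_grad _ _ beta0 gradL gamma0).
by move=> s; apply: (@measurable_answer k); exact: ltnW.
Qed.

Lemma measurable_xi k : (k < T)%N -> coord_measurable (xi k).
Proof.
move=> kT; apply: coord_measurable_clipped_noise; first exact: measurable_grad.
by move=> i; exact: mg.
Qed.

Lemma history_grad j k : (j <= k)%N ->
  @coord_measurable _ (g_sigma_algebraType (hist k)) R d (grad j).
Proof.
move=> jk; apply: (@measurable_ada_grad _ (g_sigma_algebraType (hist k))
  _ _ _ _ _ _ _ g j beta0 gradL gamma0).
by move=> s; exact: (@history_le j).
Qed.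

Lemma history_xi j k : (j < k)%N ->
  @coord_measurable _ (g_sigma_algebraType (hist k)) R d (xi j).
Proof.
move=> jk; apply: (@coord_measurable_clipped_noise _ _ _ _ _ (g_sigma_algebraType (hist k))).
  by apply: history_grad; exact: ltnW.
exact: history_answer.
Qed.

Lemma grad_bounded k : exists M : R, forall x, enorm (grad k x) <= M.
Proof.
exists (enorm (gradf w1) + beta * (k%:R * eta)) => x.
exact: ada_grad_le.
Qed.

Lemma std_bounded k : exists M : R, forall x, std k x <= M.
Proof.
have [M gM] := grad_bounded k; exists (Num.sqrt (s0 ^+ 2 + s1 ^+ 2 * M ^+ 2)) => x.
have M0 : 0 <= M by apply: le_trans (gM x); exact: enorm_ge0.
rewrite ler_sqrt; last by rewrite addr_ge0 ?sqr_ge0// mulr_ge0 ?sqr_ge0.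
rewrite lerD2l ler_wpM2l ?sqr_ge0// -enorm_sqr ler_sqr ?nnegrE ?enorm_ge0//.
Qed.

Lemma bounded_mfun_grad k i : (k < T)%N -> bounded_mfun (fun x => grad k x ord0 i).
Proof.
move=> kT; split; first exact: measurable_grad.
have [M gM] := grad_bounded k; exists M => x.
exact: le_trans (coord_le_enorm _ _) (gM x).
Qed.

Lemma bounded_mfun_xi k i : (k < T)%N -> bounded_mfun (fun x => xi k x ord0 i).
Proof.
move=> kT; split; first exact: measurable_xi.
have [M gM] := std_bounded k; exists M => x.
exact: le_trans (coord_le_enorm _ _) (le_trans (enorm_clipped_noise_le _ _ _ _) (gM x)).
Qed.

(** The answers are not assumed integrable. They agree almost surely with [grad] minus [xi], both
    bounded, so the integral can be split and unbiasedness cancels the gradient part. *)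
Lemma xi_set_integral k i A : (k < T)%N -> <<s hist k >> A ->
  (\int[P]_(x in A) xi k x ord0 i = 0)%R.
Proof.
move=> kT HA.
have mA : measurable A := g_sigma_sub_measurable (history_measurable kT) HA.
have kT' : (1 <= k.+1 <= T)%N by [].
have bg := bounded_mfun_grad i kT; have bx := bounded_mfun_xi i kT.
have ig : P.-integrable A (EFin \o (fun x => grad k x ord0 i)).
  exact: integrableS (@measurableT _ Om) mA (@subsetT _ A) (bounded_mfun_integrable P bg).
have ix : P.-integrable A (EFin \o (fun x => xi k x ord0 i)).
  exact: integrableS (@measurableT _ Om) mA (@subsetT _ A) (bounded_mfun_integrable P bx).
have e1 : (\int[P]_(x in A) g k.+1 x ord0 i = \int[P]_(x in A) grad k x ord0 i)%R.
  by rewrite /Rintegral (unbiased i kT' HA).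
have e2 : (\int[P]_(x in A) g k.+1 x ord0 i =
           \int[P]_(x in A) (grad k x ord0 i - xi k x ord0 i))%R.
  rewrite /Rintegral; congr fine; apply: ae_eq_integral => //.
  - by apply/measurable_EFinP; apply: measurable_funTS; exact: mg.
  - apply/measurable_EFinP; apply: measurable_funTS; apply: measurable_funB.
      exact: bg.1.
    exact: bx.1.
  - move: (noise kT'); apply: filterS => x h _.
    by rewrite /xi clipped_noiseE// !mxE opprB addrC subrK.
move: e2; rewrite e1 RintegralB// => /eqP.
by rewrite -subr_eq0 opprB addrC subrK => /eqP.
Qed.

Section Weighted.
Variables (c : nat -> Om -> R).
Hypothesis c_hist : forall j k, (j <= k)%N -> sub_measurable (hist k) (c j).
Hypothesis c_ge0 : forall k x, 0 <= c k x.
Hypothesis c_bnd : forall k, exists M : R, forall x, c k x <= M.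

(** The weight [c] is eta / H_k for the function values and the constant 1 for the gradient sum. *)
Let Z k x := c k x * dotp (grad k x) (xi k x).
Let D k x := c k x * (enorm (grad k x) * std k x).

Lemma c_measurable k : (k < T)%N -> measurable_fun setT (c k).
Proof.
by move=> kT; apply: (sub_measurable_measurable (history_measurable kT)); exact: c_hist.
Qed.

(** Coordinate by coordinate, [Phi], the weight and the gradient form one bounded multiplier that is
    measurable for the history. *)
Lemma weighted_orthogonal k Phi : (k < T)%N -> sub_measurable (hist k) Phi ->
  (exists b : R, forall x, `|Phi x| <= b) -> (\int[P]_x (Phi x * Z k x) = 0)%R.
Proof.
move=> kT mPhi [b Phib].
have mPhi' : measurable_fun setT Phi := sub_measurable_measurable (history_measurable kT) mPhi.
have bP : bounded_mfun Phi by split => //; exists b.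
have bc : bounded_mfun (c k).
  split; first exact: c_measurable.
  by have [M cM] := c_bnd k; exists M => x; rewrite ger0_norm.
have bi i : bounded_mfun (fun x => Phi x * c k x * grad k x ord0 i).
  by apply: bounded_mfunM; [exact: bounded_mfunM|exact: bounded_mfun_grad].
transitivity (\int[P]_x \sum_(i < d) Phi x * c k x * grad k x ord0 i * xi k x ord0 i)%R.
  apply: eq_Rintegral => x _; rewrite /Z /dotp !mulr_sumr; apply: eq_bigr => i _.
  by rewrite !mulrA.
rewrite bounded_Rintegral_sum; last first.
  by move=> i; apply: bounded_mfunM => //; exact: bounded_mfun_xi.
rewrite big1// => i _.
apply: (orthogonal_of_set_integrals (history_measurable kT) (bounded_mfun_xi i kT)).
- by move=> A; exact: xi_set_integral.
- apply: measurable_funM; first apply: measurable_funM => //.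
    exact: c_hist.
  exact: history_grad.
- exact: (bi i).2.
Qed.

Lemma weighted_tail (lam : R) t ell : 0 < lam -> (t <= T)%N ->
  let A := [set x | lam * \sum_(k < t) D k x ^+ 2 + ell / lam < \sum_(k < t) Z k x] in
  measurable A /\ (P A <= (expR (- ell))%:E)%E.
Proof.
apply: (@martingale_tail _ _ _ P T hist Z D).
- by move=> k; exact: history_measurable.
- move=> j k jk kT; apply: measurable_funM; first by apply: c_hist; exact: ltnW.
  apply: (@measurable_dotp _ (g_sigma_algebraType (hist k))).
    by apply: history_grad; exact: ltnW.
  exact: history_xi.
- move=> j k jk kT; apply: measurable_funM; first exact: c_hist.
  apply: measurable_funM.
    apply: (@measurable_enorm _ (g_sigma_algebraType (hist k))); exact: history_grad.
  apply: (@measurable_noise_std _ (g_sigma_algebraType (hist k))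
    _ _ _ _ _ _ _ _ _ g j beta0 gradL gamma0).
  by move=> s; exact: (@history_le j).
- move=> k kT; apply: measurable_funM; first exact: c_measurable.
  by apply: measurable_dotp; [exact: measurable_grad|exact: measurable_xi].
- move=> k x kT; rewrite /Z /D normrM ger0_norm// ler_wpM2l//.
  apply: (le_trans (dotp_le _ _)); rewrite ler_wpM2l ?enorm_ge0//.
  exact: enorm_clipped_noise_le.
- move=> k kT; have [M cM] := c_bnd k; have [N gN] := grad_bounded k.
  have [L sL] := std_bounded k; exists (M * (N * L)) => x.
  have := enorm_ge0 (grad k x); have : 0 <= std k x by exact: sqrtr_ge0.
  by move=> h1 h2; rewrite /D ler_pM ?mulr_ge0// ler_pM.
- exact: weighted_orthogonal.
Qed.

(** A union bound over t = 1, ..., T. The case t = 0 holds everywhere since ln (T / p) >= 0, so the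
    factor is T and not T + 1. *)
Lemma weighted_tail_uniform (lam p : R) : 0 < lam -> 0 < p -> p <= 1 -> (0 < T)%N ->
  exists A, [/\ measurable A, (P A <= p%:E)%E & forall x, ~ A x -> forall t, (t <= T)%N ->
    \sum_(k < t) Z k x <= lam * \sum_(k < t) D k x ^+ 2 + ln (T%:R / p) / lam].
Proof.
move=> lam0 p0 p1 T0.
have T1 : 1 <= T%:R :> R by rewrite ler1n.
have Tp0 : 0 < T%:R / p by rewrite divr_gt0//; lra.
pose A (t : nat) := [set x | lam * \sum_(k < t) D k x ^+ 2 + ln (T%:R / p) / lam
                     < \sum_(k < t) Z k x].
have tl t : (t <= T)%N -> measurable (A t) /\ (P (A t) <= (p / T%:R)%:E)%E.
  move=> tT; have [mA PA] := weighted_tail (ln (T%:R / p)) lam0 tT; split => //.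
  by rewrite (le_trans PA)// lee_fin expRN lnK ?posrE// invf_div.
exists (\big[setU/set0]_(i < T) A i.+1); split.
- by apply: bigsetU_measurable => i _; exact: (tl _ (ltn_ord i)).1.
- have mA i : (i < T)%N -> measurable (A i.+1) by move=> /tl[].
  apply: (le_trans (Boole_inequality P mA)).
  apply: (@le_trans _ _ (\sum_(i < T) (p / T%:R)%:E)%E).
    by apply: lee_sum => i _; exact: (tl _ (ltn_ord i)).2.
  rewrite sumEFin lee_fin sumr_const card_ord -[leLHS]mulr_natr mulfVK// gt_eqF//; lra.
- move=> x nA [_|t tT].
    rewrite !big_ord0 mulr0 add0r divr_ge0 ?(ltW lam0)// ln_ge0// ler_pdivlMr//; lra.
  rewrite leNgt; apply/negP => h; apply: nA.
  by rewrite -(bigcup_mkord T (fun i => A i.+1)); exists t.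
Qed.

End Weighted.

Lemma noise_failure_null k : (k < T)%N ->
  let A := [set x | ~ (sqnorm (g k.+1 x - grad k x) <= s0 ^+ 2 + s1 ^+ 2 * sqnorm (grad k x))] in
  measurable A /\ P A = 0%E.
Proof.
move=> kT A.
have mA : measurable A.
  pose h x := sqnorm (g k.+1 x - grad k x) <= s0 ^+ 2 + s1 ^+ 2 * sqnorm (grad k x).
  have mh : measurable_fun setT h.
    apply: measurable_fun_ler.
      apply: measurable_sqnorm; apply: coord_measurableB; last exact: measurable_grad.
      by move=> i; exact: mg.
    apply: measurable_funD => //; apply: measurable_funM => //.
    exact/measurable_sqnorm/measurable_grad.
  have := mh measurableT [set false] I.
  rewrite setTI; congr (measurable _); apply/seteqP; split => x /=.
    by rewrite /A/= -/(h x) => ->.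
  by rewrite /A/= -/(h x) => /negP/negbTE.
split => //; apply/negligibleP => //.
exact: (noise (t := k.+1)).
Qed.

Lemma noise_failures_null : exists A, [/\ measurable A, P A = 0%E &
  forall x, ~ A x -> forall k, (k < T)%N ->
    sqnorm (g k.+1 x - grad k x) <= s0 ^+ 2 + s1 ^+ 2 * sqnorm (grad k x)].
Proof.
pose A (k : nat) := [set x | ~ (sqnorm (g k.+1 x - grad k x)
   <= s0 ^+ 2 + s1 ^+ 2 * sqnorm (grad k x))].
have mA i : (i < T)%N -> measurable (A i) by move=> /noise_failure_null[].
exists (\big[setU/set0]_(i < T) A i); split.
- by apply: bigsetU_measurable => i _; exact: mA.
- apply/eqP; rewrite -measure_le0; apply: (le_trans (Boole_inequality P mA)).
  by rewrite big1// => i _; exact: (noise_failure_null (ltn_ord i)).2.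
- move=> x nA k kT; apply: contrapT => h; apply: nA.
  by rewrite -(bigcup_mkord T A); exists k.
Qed.

End Run.

Theorem theorem1 :
  exists C : nat,
  forall (R : realType) (d : nat)
    (f : 'rV[R]_d -> R) (gradf : 'rV[R]_d -> 'rV[R]_d) (beta fstar : R)
    (eta gamma s0 s1 : R) (T : nat) (w1 : 'rV[R]_d)
    (dm : measure_display) (Omega : measurableType dm) (P : probability Omega R)
    (g : nat -> Omega -> 'rV[R]_d) (delta : R),
  is_gradient f gradf -> 0 <= beta -> smooth_grad beta gradf ->
  (forall w, fstar <= f w) -> (exists w, f w = fstar) ->
  0 < eta -> 0 < gamma -> 0 <= s0 -> 0 <= s1 -> (0 < T)%N ->
  (* oracle answers are random vectors *)
  (forall t (i : 'I_d), (1 <= t <= T)%N ->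
     measurable_fun setT (fun x => g t x ord0 i)) ->
  (* unbiasedness: E[g_t | g_1, ..., g_{t-1}] = grad f(w_t) *)
  (forall t (i : 'I_d) (A : set Omega), (1 <= t <= T)%N ->
     <<s history g t >> A ->
     (\int[P]_(x in A) (g t x ord0 i)%:E =
      \int[P]_(x in A) (gradf (ada_w eta gamma w1 (g^~ x) t) ord0 i)%:E)%E) ->
  (* bounded affine noise, almost surely *)
  (forall t, (1 <= t <= T)%N ->
     \forall x \ae P,
       sqnorm (g t x - gradf (ada_w eta gamma w1 (g^~ x) t))
       <= s0 ^+ 2 + s1 ^+ 2 * sqnorm (gradf (ada_w eta gamma w1 (g^~ x) t))) ->
  0 < delta -> delta < 1 / 3 ->
  let D1 := f w1 - fstar in
  let F := Fbound eta gamma beta s0 s1 D1 delta T in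
  let K := 2 * F / eta + eta * beta in
  exists E : set Omega, [/\ measurable E, ((1 - delta)%:E <= P E)%E &
    forall x, E x ->
      (T%:R^-1 * \sum_(1 <= t < T.+1) sqnorm (gradf (ada_w eta gamma w1 (g^~ x) t))
        <= C%:R * K * s0 / Num.sqrt T%:R
           + C%:R * (gamma / eta * D1
                     + (1 + s1 ^+ 2 * log2 (delta^-1)) * K ^+ 2
                     + s0 ^+ 2 * log2 (delta^-1)) / T%:R)
      /\ (forall t, (1 <= t <= T.+1)%N ->
            f (ada_w eta gamma w1 (g^~ x) t) - fstar <= F)].
Proof.
exists 20%N => R d f gradf beta fstar eta gamma s0 s1 T w1 dm Om P g delta.
move=> fgrad beta0 gradL fmin _ eta0 gamma0 s00 s10 T0 mg unb noise d0 d1 D1 F K.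
pose grad k x := gradf (ada_w eta gamma w1 (g^~ x) k.+1).
pose xi k x := clipped_noise s0 s1 (grad k x) (g k.+1 x).
pose wd k x := enorm (grad k x) * noise_std s0 s1 (grad k x).
pose c k x := eta / pred_norm gamma s0 s1 (g^~ x) (grad k x) k.
pose B := eta * (s0 + s1 * Num.sqrt (2 * beta * F)).
pose S2 := s0 ^+ 2 + s1 ^+ 2 * (2 * beta * F).
have [A0 [mA0 PA0 okA0]] := noise_failures_null beta0 gradL gamma0 mg noise.
have [A1 [mA1 PA1 okA1]] : exists A, [/\ measurable A, (P A <= (3 / 4 * delta)%:E)%E &
    forall x, ~ A x -> 0 < B -> forall t, (t <= T)%N ->
    \sum_(k < t) c k x * dotp (grad k x) (xi k x) <=
    13 / 20 / B * \sum_(k < t) (c k x * wd k x) ^+ 2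
    + ln (T%:R / (3 / 4 * delta)) / (13 / 20 / B)].
  (* B depends on the parameters only, so [lam] may be chosen from it before any trajectory is
     fixed. If B is not positive the claim is void and the empty set serves. *)
  have [Bp|Bn] := ltP 0 B; last first.
    by exists set0; split => //; rewrite measure0 lee_fin; lra.
  have lam0 : 0 < 13 / 20 / B by rewrite !divr_gt0.
  have p0 : 0 < 3 / 4 * delta by lra.
  have p1 : 3 / 4 * delta <= 1 by lra.
  have c_hist j k : (j <= k)%N -> sub_measurable (history g k.+1) (c j).
    move=> jk; apply: (@measurable_pred_step _ (g_sigma_algebraType (history g k.+1)) _ _
       _ _ _ _ _ _ _ g j beta0 gradL gamma0).
    by move=> s; exact: history_le.
  have c_ge0 k x : 0 <= c k x.
    by rewrite divr_ge0 ?(ltW eta0)// ltW// pred_norm_gt0.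
  have c_bnd k : exists M : R, forall x, c k x <= M.
    exists (eta / gamma) => x; rewrite ler_pM2l// lef_pV2 ?posrE ?pred_norm_gt0//.
    exact: gamma_le_pred_norm.
  have [A [mA PA okA]] := weighted_tail_uniform beta0 gradL eta0 gamma0 mg unb noise
    c_hist c_ge0 c_bnd lam0 p0 p1 T0.
  by exists A; split => // x nA _; exact: okA.
have [A2 [mA2 PA2 okA2]] : exists A, [/\ measurable A, (P A <= (1 / 4 * delta)%:E)%E &
    forall x, ~ A x -> 0 < S2 ->
    \sum_(k < T) dotp (grad k x) (xi k x) <=
    (4 * S2)^-1 * \sum_(k < T) (wd k x) ^+ 2
    + ln (1 / (1 / 4 * delta)) / (4 * S2)^-1].
  have [Sp|Sn] := ltP 0 S2; last first.
    by exists set0; split => //; rewrite measure0 lee_fin; lra.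
  have lam0 : 0 < (4 * S2)^-1 by rewrite invr_gt0 mulr_gt0.
  pose c2 (k : nat) (x : Om) : R := 1.
  have c2_hist j k : (j <= k)%N -> sub_measurable (history g k.+1) (c2 j).
    by move=> _; exact: measurable_cst.
  have c2_bnd k : exists M : R, forall x, c2 k x <= M by exists 1.
  have [mA PA] := weighted_tail beta0 gradL eta0 gamma0 mg unb noise
    c2_hist (fun _ _ => ler01) c2_bnd (ln (1 / (1 / 4 * delta))) lam0 (leqnn T).
  eexists; split; first exact: mA.
    rewrite (le_trans PA)// lee_fin expRN lnK ?posrE; last by rewrite divr_gt0//; lra.
    by rewrite invf_div divr1.
  move=> x nA _; rewrite leNgt; apply/negP => h; apply: nA => /=.
  by under eq_bigr do rewrite mul1r; under [ltRHS]eq_bigr do rewrite mul1r.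
(* [A0], where the noise bound fails, is null; the other two sets use up the shares 3/4 and 1/4 of
   [delta]. Outside [A0] the clipped noise is the true one. *)
pose Bad := A0 `|` A1 `|` A2.
have mBad : measurable Bad by do 2 (apply: measurableU => //).
exists (~` Bad); split; first exact: measurableC.
  rewrite probability_setC// -(fineK (fin_num_measure P Bad mBad)) -EFinB lee_fin.
  suff : fine (P Bad) <= delta by lra.
  rewrite -lee_fin fineK ?fin_num_measure//.
  apply: (le_trans (measureU2 _ (measurableU _ _ mA0 mA1) mA2)).
  apply: (@le_trans _ _ ((3 / 4 * delta)%:E + (1 / 4 * delta)%:E)%E); last first.
    by rewrite -EFinD lee_fin; lra.
  have U01 : (P (A0 `|` A1) <= P A0 + P A1)%E by exact: measureU2.
  by apply: leeD => //; apply: (le_trans U01); rewrite PA0 add0e.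
move=> x /= nBad.
have nA0 : ~ A0 x by move=> h; apply: nBad; left; left.
have nA1 : ~ A1 x by move=> h; apply: nBad; left; right.
have nA2 : ~ A2 x by move=> h; apply: nBad; right.
have ok k : (k < T)%N -> sqnorm (g k.+1 x - grad k x) <= s0 ^+ 2 + s1 ^+ 2 * sqnorm (grad k x).
  exact: okA0.
have xiE k : (k < T)%N -> xi k x = grad k x - g k.+1 x.
  by move=> kT; rewrite /xi clipped_noiseE// ok.
apply: (@path_bounds R d f gradf beta fstar eta gamma s0 s1 T w1 (g^~ x) beta0 gradL
  eta0 gamma0 fgrad fmin s00 s10 T0 ok delta d0 d1).
- move=> Bp t tT; have := okA1 x nA1 Bp t tT.
  by under eq_bigr => k _ do rewrite (xiE _ (leq_trans (ltn_ord k) tT)).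
- move=> Sp; have := okA2 x nA2 Sp.
  by under eq_bigr => k _ do rewrite (xiE _ (ltn_ord k)).
Qed.
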